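(* A holomorphic motion of the unit circle is uniquely determined by its graph. That is, if $W^1,W^2:\Delta\times\mathbb{S}^1\to\mathbb{C}$ are holomorphic motions of the unit circle with graphs satisfying $\mathscr{B}_{W^1}=\mathscr{B}_{W^2}$, then $W^1=W^2$ on $\Delta\times\mathbb{S}^1$.
   Context: $\Delta$ is the open unit disk in $\mathbb{C}$ and $\mathbb{S}^1=\partial\Delta$. A holomorphic motion of a set $E\subset\overline{\mathbb{C}}$ with at least 3 points is a function $W:\Delta\times E\to\overline{\mathbb{C}}$ such that $W(0,s)=s$ for all $s\in E$; $t\mapsto W(t,s)$ is holomorphic for each $s\in E$; and $s\mapsto W_t(s):=W(t,s)$ is injective for each $t\in\Delta$. A holomorphic motion $W:\Delta\times\mathbb{S}^1\to\mathbb{C}$ of the unit circle extends to a holomorphic motion $W:\Delta\times\Delta\to\mathbb{C}$ of the unit disk (Slodkowski's theorem and the $\lambda$-lemma). The *graph* of $W$ is the domain $\mathscr{B}_W=\{(t,W(t,z)):t,z\in\Delta\}\subset\mathbb{C}^2$, which does not depend on the choice of the extension. *)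

(* Defs.v *)
From Stdlib Require Import Reals.
From Coquelicot Require Import Coquelicot.

Open Scope R_scope.

Definition unit_disk (z : C) : Prop := Cmod z < 1.
Definition unit_circle (z : C) : Prop := Cmod z = 1.
Definition closed_unit_disk (z : C) : Prop := Cmod z <= 1.

(* Coquelicot's [ex_derive] over the scalar field C is complex
   differentiability; at points of the open unit disk it does not see the
   values of [f] outside the disk. *)
Definition holomorphic_on_disk (f : C -> C) : Prop :=
  forall t : C, unit_disk t ->
    ex_derive (K := C_AbsRing) (V := C_NormedModule) f t.

(* Holomorphic motions of E with E and all the values in C rather than in the
   Riemann sphere.  [W] is total; only its values on unit_disk x E matter. *)
Record holomorphic_motion (E : C -> Prop) (W : C -> C -> C) : Prop := {
  motion_three_points :
    exists a b c : C, E a /\ E b /\ E c /\ a <> b /\ b <> c /\ a <> c;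
  motion_at_0 : forall s : C, E s -> W (RtoC 0) s = s;
  motion_holomorphic :
    forall s : C, E s -> holomorphic_on_disk (fun t => W t s);
  motion_injective : forall t : C, unit_disk t ->
    forall s s' : C, E s -> E s' -> W t s = W t s' -> s = s'
}.

(* The disk and the circle are disjoint, so "V extends W" is a condition on the
   motion of their union, the closed disk. *)
Definition extends_to_disk (W V : C -> C -> C) : Prop :=
  holomorphic_motion closed_unit_disk V /\
  forall t s : C, unit_disk t -> unit_circle s -> V t s = W t s.

(* A relation and not a function of W, since the graph is read off an extension
   V of W: such a V exists by Slodkowski's theorem, and B is the same for every
   choice of V.  Neither fact is built into the definition. *)
Definition is_graph (W : C -> C -> C) (B : C * C -> Prop) : Prop :=
  exists V : C -> C -> C, extends_to_disk W V /\
    forall p : C * C,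
      B p <-> exists t z : C, unit_disk t /\ unit_disk z /\ p = (t, V t z).

(* Main.v *)
Require Import Defs.
From Stdlib Require Import Reals Ranalysis5 Lra Lia ClassicalEpsilon.
From Coquelicot Require Import Coquelicot.
Open Scope R_scope.

(** Let [V1], [V2] be motions of the closed disk extending [W1], [W2], and let
    [s] be a point of the unit circle.  Write [f t = V1 t s] and
    [g z t = V2 t z].  When [z] lies in the open disk, [f] and [g z] never take
    the same value at the same time: [(t, g z t)] belongs to the common graph,
    hence equals [(t, V1 t z')] with [z'] in the open disk, and [V1 t] is
    injective on the closed disk.  So [f - g z] is a holomorphic function
    without zeros whose value [s - z] at time 0 tends to 0 as [z] tends to [s].
    By Hurwitz's principle it tends to 0 everywhere, that is, [g z t] tends to
    [f t].  The same argument with [g s] in place of [f] shows that [g z t]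
    tends to [g s t].  Hence [f = g s].

    The quantitative form of Hurwitz's principle used here is Harnack's
    inequality for [log |h|] when [h] is bounded and has no zeros
    ([harnack_nonvanishing], [nowhere_equal_close]); it comes from the Schwarz
    lemma applied to a holomorphic logarithm of [h].  It requires a bound on
    [g z], for [t] in a fixed disk, that is uniform in [z] near the circle
    ([motion_bounded_near_circle]).  The usual source of such a bound is
    Montel's theorem on functions omitting three values.  A more elementary
    route is open because the motion is defined on a whole disk:
    - by Baire's theorem the sets of those [z] for which [g z] is bounded by
      [N] on the disk of radius 1/2 cannot all be nowhere dense, and Harnack's
      inequality turns density in a rectangle into a uniform bound on a disk [D]
      of centre [a];
    - for small [t] the map [z |-> g z t] is then continuous on [D] and close
      to the identity, so its image contains a fixed neighbourhood of [a], by
      the argument behind Brouwer's theorem in the plane ([disc_covering]);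
    - by injectivity the functions [g z] with [z] outside [D] stay away from
      [a], so [1 / (g z - a)] is bounded, and Harnack's inequality, now used as
      a lower bound for this function, bounds [g z].

    The bound holds only for small [t], and so does the equality [f = g s]
    obtained from it; the identity theorem propagates the equality to the disk.

    The underlying function theory starts from complex differentiability alone.
    Goursat's theorem on rectangles, applied to [w |-> f (p + exp w)], gives
    the mean value property, because the two horizontal sides of a rectangle of
    height [2 PI] cancel.  The mean value property gives the maximum principle
    and the Schwarz lemma.  Iterating the Schwarz lemma gives the identity
    theorem without power series. *)

(** * Complex continuity and differentiability *)

(** [C] carries two uniform structures, that of [C_AbsRing] and the product one.
    The first is used throughout, for its balls are those of [Cmod]. *)
Definition Ccont (f : C -> C) (z : C) : Prop :=
  continuous (T := AbsRing_UniformSpace C_AbsRing)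
    (U := AbsRing_UniformSpace C_AbsRing) f z.

Definition Cderiv (f : C -> C) (z l : C) : Prop :=
  is_derive (K := C_AbsRing) (V := AbsRing_NormedModule C_AbsRing) f z l.

Definition Cdiff (f : C -> C) (z : C) : Prop := exists l, Cderiv f z l.

Lemma Ccont_eps f z : Ccont f z <-> forall eps, 0 < eps ->
  exists d, 0 < d /\ forall w, Cmod (w - z) < d -> Cmod (f w - f z) < eps.
Proof.
split.
- intros H eps He.
  destruct (H _ (locally_ball (T := AbsRing_UniformSpace C_AbsRing) (f z)
                   (mkposreal eps He))) as [d Hd].
  exists d; split; [apply cond_pos | exact Hd].
- intros H P [e He]. destruct (H e (cond_pos e)) as [d [Hd H1]].
  exists (mkposreal d Hd). intros w Hw. apply He. exact (H1 w Hw).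
Qed.

Lemma Cderiv_eps f z l : Cderiv f z l <-> forall eps, 0 < eps ->
  exists d, 0 < d /\ forall w, Cmod (w - z) < d ->
    Cmod (f w - f z - (w - z) * l) <= eps * Cmod (w - z).
Proof.
split.
- intros [_ H] eps He.
  assert (Hz : is_filter_lim (T := AbsRing_UniformSpace C_AbsRing)
      (locally (T := AbsRing_UniformSpace C_AbsRing) z) z)
    by (intros P HP; exact HP).
  destruct (H z Hz (mkposreal eps He)) as [d Hd].
  exists d; split; [apply cond_pos | exact Hd].
- intros H. split.
  { exact (is_linear_scal_l (K := C_AbsRing)
             (V := AbsRing_NormedModule C_AbsRing) l). }
  intros x Hx e.
  assert (E : z = x) by exact (is_filter_lim_locally_unique (K := C_AbsRing)
                                 (V := AbsRing_NormedModule C_AbsRing) z x Hx).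
  subst x. destruct (H e (cond_pos e)) as [d [Hd H1]].
  exists (mkposreal d Hd). exact H1.
Qed.

(** The two uniform structures on the target have the same norm, and only the
    norm enters the definition of the derivative. *)
Lemma Cdiff_ex_derive f z :
  ex_derive (K := C_AbsRing) (V := C_NormedModule) f z -> Cdiff f z.
Proof.
intros [l [_ H]]. exists l. apply Cderiv_eps. intros eps He.
assert (Hz : is_filter_lim (T := AbsRing_UniformSpace C_AbsRing)
    (locally (T := AbsRing_UniformSpace C_AbsRing) z) z)
  by (intros P HP; exact HP).
destruct (H z Hz (mkposreal eps He)) as [d Hd].
exists d; split; [apply cond_pos | exact Hd].
Qed.

Lemma Ccont_const c z : Ccont (fun _ => c) z.
Proof.
exact (continuous_const (U := AbsRing_UniformSpace C_AbsRing)
         (V := AbsRing_UniformSpace C_AbsRing) c z).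
Qed.

Lemma Ccont_id z : Ccont (fun w => w) z.
Proof. exact (continuous_id (U := AbsRing_UniformSpace C_AbsRing) z). Qed.

Lemma Ccont_plus f g z : Ccont f z -> Ccont g z -> Ccont (fun w => f w + g w)%C z.
Proof.
exact (continuous_plus (U := AbsRing_UniformSpace C_AbsRing) (K := C_AbsRing)
         (V := AbsRing_NormedModule C_AbsRing) f g z).
Qed.

Lemma Ccont_mult f g z : Ccont f z -> Ccont g z -> Ccont (fun w => f w * g w)%C z.
Proof.
exact (continuous_mult (U := AbsRing_UniformSpace C_AbsRing) (K := C_AbsRing) f g z).
Qed.

Lemma Ccont_minus f g z : Ccont f z -> Ccont g z -> Ccont (fun w => f w - g w)%C z.
Proof.
exact (continuous_minus (U := AbsRing_UniformSpace C_AbsRing) (K := C_AbsRing)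
         (V := AbsRing_NormedModule C_AbsRing) f g z).
Qed.

Lemma Ccont_comp f g z : Ccont f z -> Ccont g (f z) -> Ccont (fun w => g (f w)) z.
Proof.
exact (continuous_comp (U := AbsRing_UniformSpace C_AbsRing)
         (V := AbsRing_UniformSpace C_AbsRing)
         (W := AbsRing_UniformSpace C_AbsRing) f g z).
Qed.

Lemma Cdiff_cont f z : Cdiff f z -> Ccont f z.
Proof.
exact (ex_derive_continuous (K := C_AbsRing)
         (V := AbsRing_NormedModule C_AbsRing) f z).
Qed.

Lemma Cdiff_const c z : Cdiff (fun _ => c) z.
Proof.
exact (ex_derive_const (K := C_AbsRing)
         (V := AbsRing_NormedModule C_AbsRing) c z).
Qed.

Lemma Cdiff_id z : Cdiff (fun w => w) z.
Proof. exact (ex_derive_id (K := C_AbsRing) z). Qed.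

Lemma Cdiff_plus f g z : Cdiff f z -> Cdiff g z -> Cdiff (fun w => f w + g w)%C z.
Proof.
exact (ex_derive_plus (K := C_AbsRing)
         (V := AbsRing_NormedModule C_AbsRing) f g z).
Qed.

Lemma Cdiff_minus f g z : Cdiff f z -> Cdiff g z -> Cdiff (fun w => f w - g w)%C z.
Proof.
exact (ex_derive_minus (K := C_AbsRing)
         (V := AbsRing_NormedModule C_AbsRing) f g z).
Qed.

Lemma Cdiff_mult f g z : Cdiff f z -> Cdiff g z -> Cdiff (fun w => f w * g w)%C z.
Proof.
intros [a Ha] [b Hb]. eexists.
exact (is_derive_mult (K := C_AbsRing) f g z a b Ha Hb Cmult_comm).
Qed.

Lemma Cdiff_comp f g z : Cdiff f (g z) -> Cdiff g z -> Cdiff (fun w => f (g w)) z.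
Proof.
intros [a Ha] [b Hb]. eexists.
exact (is_derive_comp (K := C_AbsRing)
         (V := AbsRing_NormedModule C_AbsRing) f g z a b Ha Hb).
Qed.

Lemma Ccont_ext_near f g z d : 0 < d ->
  (forall w, Cmod (w - z) < d -> f w = g w) -> Ccont f z -> Ccont g z.
Proof.
intros Hd E H. apply Ccont_eps. intros eps He.
destruct (proj1 (Ccont_eps f z) H eps He) as [d' [Hd' H']].
assert (E0 : f z = g z).
{ apply E. replace (z - z)%C with (RtoC 0) by ring. now rewrite Cmod_0. }
exists (Rmin d d'); split; [now apply Rmin_glb_lt |].
intros w Hw. rewrite <- E0, <- E.
- apply H'. eapply Rlt_le_trans; [exact Hw | apply Rmin_r].
- eapply Rlt_le_trans; [exact Hw | apply Rmin_l].
Qed.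

Lemma Cdiff_ext_near f g z d : 0 < d ->
  (forall w, Cmod (w - z) < d -> f w = g w) -> Cdiff f z -> Cdiff g z.
Proof.
intros Hd E [l H]. exists l. apply Cderiv_eps. intros eps He.
destruct (proj1 (Cderiv_eps f z l) H eps He) as [d' [Hd' H']].
assert (E0 : f z = g z).
{ apply E. replace (z - z)%C with (RtoC 0) by ring. now rewrite Cmod_0. }
exists (Rmin d d'); split; [now apply Rmin_glb_lt |].
intros w Hw. rewrite <- E0, <- E.
- apply H'. eapply Rlt_le_trans; [exact Hw | apply Rmin_r].
- eapply Rlt_le_trans; [exact Hw | apply Rmin_l].
Qed.

(** Carathéodory's form: it trades remainder estimates for continuity of the
    difference quotient, which is how removable singularities (in [schwarz])
    and inverse functions (in [Cdiff_log]) are handled. *)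
Lemma Cderiv_slope f z l : Cderiv f z l <->
  Ccont (fun w => if Ceq_dec w z then l else (f w - f z) / (w - z))%C z.
Proof.
rewrite Cderiv_eps, Ccont_eps.
assert (K : forall w, w <> z ->
  (f w - f z - (w - z) * l = (w - z) * ((f w - f z) / (w - z) - l))%C).
{ intros w Hw. field. now apply Cminus_eq_contra. }
split; intros H eps He.
- destruct (H (eps / 2)) as [d [Hd H']]; [lra |].
  exists d; split; [exact Hd |]. intros w Hw.
  destruct (Ceq_dec z z) as [_ |]; [| easy].
  destruct (Ceq_dec w z) as [-> | n].
  { replace (l - l)%C with (RtoC 0) by ring. now rewrite Cmod_0. }
  specialize (H' w Hw). rewrite (K w n), Cmod_mult in H'.
  assert (P : 0 < Cmod (w - z)) by now apply Cmod_gt_0, Cminus_eq_contra.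
  rewrite Rmult_comm in H'. apply Rmult_le_reg_r in H'; lra.
- destruct (H eps He) as [d [Hd H']].
  exists d; split; [exact Hd |]. intros w Hw. specialize (H' w Hw).
  destruct (Ceq_dec z z) as [_ |]; [| easy].
  destruct (Ceq_dec w z) as [-> | n].
  { replace (f z - f z - (z - z) * l)%C with (RtoC 0) by ring.
    replace (z - z)%C with (RtoC 0) by ring. rewrite Cmod_0. lra. }
  rewrite (K w n), Cmod_mult, Rmult_comm.
  apply Rmult_le_compat_r; [apply Cmod_ge_0 | lra].
Qed.

Lemma Cmod_triangle_rev a b : Cmod a - Cmod b <= Cmod (a - b).
Proof.
generalize (Cmod_triangle (a - b) b). replace (a - b + b)%C with a by ring. lra.
Qed.

Lemma Cmod_minus_comm a b : Cmod (a - b) = Cmod (b - a).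
Proof. rewrite <- (Cmod_opp (a - b)). f_equal. ring. Qed.

Lemma Cderiv_inv (z : C) : z <> 0 -> Cderiv Cinv z (- / (z * z))%C.
Proof.
intros Hz. apply Cderiv_eps. intros eps He.
assert (P : 0 < Cmod z) by now apply Cmod_gt_0.
set (m := Cmod z) in *.
exists (Rmin (m / 2) (eps * (m * m * m) / 2)); split.
{ apply Rmin_glb_lt; [lra |].
  assert (0 < m * m * m) by now repeat apply Rmult_lt_0_compat. nra. }
intros w Hw.
assert (H1 : Cmod (w - z) < m / 2) by (eapply Rlt_le_trans; [exact Hw | apply Rmin_l]).
assert (H2 : Cmod (w - z) < eps * (m * m * m) / 2) by (eapply Rlt_le_trans; [exact Hw | apply Rmin_r]).
assert (H3 : m / 2 < Cmod w).
{ generalize (Cmod_triangle_rev z w). rewrite Cmod_minus_comm. fold m. lra. }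
assert (Hw0 : w <> 0) by (apply Cmod_gt_0; lra).
replace (/ w - / z - (w - z) * - / (z * z))%C
  with ((w - z) * ((w - z) / (w * (z * z))))%C by (field; auto).
rewrite Cmod_mult, Rmult_comm. apply Rmult_le_compat_r; [apply Cmod_ge_0 |].
rewrite Cmod_div by (repeat apply Cmult_neq_0; auto).
rewrite !Cmod_mult. fold m.
assert (0 < m * m) by now apply Rmult_lt_0_compat.
apply Rmult_le_reg_r with (Cmod w * (m * m)); [apply Rmult_lt_0_compat; lra |].
unfold Rdiv. rewrite Rmult_assoc, Rinv_l by (apply Rgt_not_eq, Rmult_lt_0_compat; lra).
assert (eps * (m * m) * (m / 2) <= eps * (m * m) * Cmod w).
{ apply Rmult_le_compat_l; [apply Rlt_le, Rmult_lt_0_compat |]; lra. }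
lra.
Qed.

Lemma Cdiff_div f g z : Cdiff f z -> Cdiff g z -> g z <> 0 ->
  Cdiff (fun w => f w / g w)%C z.
Proof.
intros Hf Hg Hz. apply Cdiff_mult; [exact Hf |].
apply (Cdiff_comp Cinv g); [| exact Hg]. eexists. now apply Cderiv_inv.
Qed.

Lemma Ccont_div f g z : Ccont f z -> Ccont g z -> g z <> 0 ->
  Ccont (fun w => f w / g w)%C z.
Proof.
intros Hf Hg Hz. apply Ccont_mult; [exact Hf |].
apply (Ccont_comp g Cinv); [exact Hg |].
apply Cdiff_cont. eexists. now apply Cderiv_inv.
Qed.

Lemma Ccont_Re f z : Ccont f z -> Ccont (fun w => RtoC (Re (f w))) z.
Proof.
rewrite !Ccont_eps. intros H eps He. destruct (H eps He) as [d [Hd H']].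
exists d; split; [exact Hd |]. intros w Hw.
rewrite <- RtoC_minus, Cmod_R.
replace (Re (f w) - Re (f z)) with (Re (f w - f z)%C) by reflexivity.
eapply Rle_lt_trans; [apply re_le_Cmod | now apply H'].
Qed.

Lemma im_le_Cmod c : Rabs (Im c) <= Cmod c.
Proof. eapply Rle_trans; [apply Rmax_r | apply (Rmax_Cmod c)]. Qed.

Lemma Ccont_Im f z : Ccont f z -> Ccont (fun w => RtoC (Im (f w))) z.
Proof.
rewrite !Ccont_eps. intros H eps He. destruct (H eps He) as [d [Hd H']].
exists d; split; [exact Hd |]. intros w Hw.
rewrite <- RtoC_minus, Cmod_R.
replace (Im (f w) - Im (f z)) with (Im (f w - f z)%C) by reflexivity.
eapply Rle_lt_trans; [apply im_le_Cmod | now apply H'].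
Qed.

Lemma Ccont_Cmod f z : Ccont f z -> Ccont (fun w => RtoC (Cmod (f w))) z.
Proof.
rewrite !Ccont_eps. intros H eps He. destruct (H eps He) as [d [Hd H']].
exists d; split; [exact Hd |]. intros w Hw.
rewrite <- RtoC_minus, Cmod_R.
eapply Rle_lt_trans; [| now apply (H' w)].
apply Rabs_le. generalize (Cmod_triangle_rev (f w) (f z)) (Cmod_triangle_rev (f z) (f w)).
rewrite (Cmod_minus_comm (f z)). lra.
Qed.

Lemma Ccont_real_comp (phi : R -> R) (u : C -> R) z :
  continuous phi (u z) -> Ccont (fun w => RtoC (u w)) z ->
  Ccont (fun w => RtoC (phi (u w))) z.
Proof.
rewrite !Ccont_eps. intros H Hu eps He.
destruct (H _ (locally_ball (phi (u z)) (mkposreal eps He))) as [d Hd].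
destruct (Hu d (cond_pos d)) as [d' [Hd' H']].
exists d'; split; [exact Hd' |]. intros w Hw.
rewrite <- RtoC_minus, Cmod_R. apply (Hd (u w)).
specialize (H' w Hw). rewrite <- RtoC_minus, Cmod_R in H'. exact H'.
Qed.

(** * The exponential and the principal logarithm *)

Definition Cexp (z : C) : C := (exp (Re z) * cos (Im z), exp (Re z) * sin (Im z)).

Lemma Cexp_plus z w : Cexp (z + w) = (Cexp z * Cexp w)%C.
Proof.
unfold Cexp. rewrite re_plus, im_plus, exp_plus, cos_plus, sin_plus.
apply injective_projections; simpl; ring.
Qed.

Lemma Cexp_0 : Cexp 0 = 1.
Proof.
unfold Cexp; simpl. rewrite exp_0, cos_0, sin_0.
apply injective_projections; simpl; ring.
Qed.

Lemma Cmod_Cexp z : Cmod (Cexp z) = exp (Re z).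
Proof.
unfold Cmod, Cexp. cbn [fst snd].
replace ((exp (Re z) * cos (Im z)) ^ 2 + (exp (Re z) * sin (Im z)) ^ 2)
  with (Rsqr (exp (Re z))).
- apply sqrt_Rsqr, Rlt_le, exp_pos.
- generalize (sin2_cos2 (Im z)). unfold Rsqr. intros H.
  transitivity (exp (Re z) * exp (Re z) * (sin (Im z) * sin (Im z) + cos (Im z) * cos (Im z)));
    [rewrite H |]; ring.
Qed.

Lemma Cexp_neq_0 z : Cexp z <> 0.
Proof. apply Cmod_gt_0. rewrite Cmod_Cexp. apply exp_pos. Qed.

Lemma Cmod_le_abs (x y : R) : Cmod (x, y) <= Rabs x + Rabs y.
Proof.
replace (x, y) with (RtoC x + Ci * RtoC y)%C
  by (apply injective_projections; simpl; ring).
eapply Rle_trans; [apply Cmod_triangle |].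
rewrite Cmod_mult, Cmod_Ci, !Cmod_R. lra.
Qed.

Lemma is_derive_0_eps (f : R -> R) (l : R) : is_derive f 0 l -> forall eps, 0 < eps ->
  exists d, 0 < d /\ forall x, Rabs x < d -> Rabs (f x - f 0 - x * l) <= eps * Rabs x.
Proof.
intros [_ H] eps He.
destruct (H 0 (fun P HP => HP) (mkposreal eps He)) as [d Hd].
exists d; split; [apply cond_pos |]. intros x Hx.
assert (E : x - 0 = x) by ring.
specialize (Hd x). unfold ball, norm, minus, plus, opp, scal in Hd. simpl in Hd.
unfold AbsRing_ball, abs, minus, plus, opp, mult in Hd. simpl in Hd.
unfold mult in Hd; simpl in Hd.
replace (x + - 0) with x in Hd by ring. unfold Rminus. auto.
Qed.

(** With [z = x + i y], the remainder splits as
    [(exp x - 1 - x) e^(i y) + (1 + x) (e^(i y) - 1 - i y) + i x y], which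
    reduces it to real derivatives at 0. *)
Lemma Cderiv_exp_0 : Cderiv Cexp 0 1.
Proof.
apply Cderiv_eps. intros eps He.
set (e := Rmin (eps / 8) 1).
assert (0 < e) by (apply Rmin_glb_lt; lra).
assert (He8 : e <= eps / 8) by apply Rmin_l.
assert (He1 : e <= 1) by apply Rmin_r.
destruct (is_derive_0_eps exp 1) with (eps := e) as [d1 [Hd1 H1]]; auto.
{ generalize (is_derive_exp 0). now rewrite exp_0. }
destruct (is_derive_0_eps cos 0) with (eps := e) as [d2 [Hd2 H2]]; auto.
{ generalize (is_derive_cos 0). now rewrite sin_0, Ropp_0. }
destruct (is_derive_0_eps sin 1) with (eps := e) as [d3 [Hd3 H3]]; auto.
{ generalize (is_derive_sin 0). now rewrite cos_0. }
exists (Rmin (Rmin d1 d2) (Rmin d3 e)); split.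
{ repeat apply Rmin_glb_lt; lra. }
intros [x y] Hw.
replace ((x, y) - 0)%C with (x, y) in * by (apply injective_projections; simpl; ring).
assert (L1 := re_le_Cmod (x, y)). assert (L2 := im_le_Cmod (x, y)).
simpl in L1, L2. set (m := Cmod (x, y)) in *.
apply Rmin_Rgt in Hw. destruct Hw as [Hw Hw'].
apply Rmin_Rgt in Hw, Hw'. destruct Hw as [K1 K2], Hw' as [K3 K4].
specialize (H1 x ltac:(lra)). specialize (H2 y ltac:(lra)). specialize (H3 y ltac:(lra)).
rewrite exp_0 in H1. rewrite cos_0 in H2. rewrite sin_0 in H3.
rewrite Cexp_0, Cmult_1_r.
replace (Cexp (x, y) - 1 - (x, y))%C
  with (RtoC (exp x - 1 - x * 1) * Cexp (0, y) + RtoC (1 + x) * (cos y - 1 - y * 0, sin y - 0 - y * 1)%R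
        + Ci * RtoC (x * y))%C.
2: { unfold Cexp; apply injective_projections; simpl; rewrite exp_0; ring. }
eapply Rle_trans; [apply Cmod_triangle |].
eapply Rle_trans; [apply Rplus_le_compat_r, Cmod_triangle |].
rewrite !Cmod_mult, !Cmod_R, Cmod_Ci, Cmod_Cexp. simpl (Re (0, y)). rewrite exp_0.
assert (A : Cmod (cos y - 1 - y * 0, sin y - 0 - y * 1) <= 2 * e * m).
{ eapply Rle_trans; [apply Cmod_le_abs |]. nra. }
assert (B : Rabs (1 + x) <= 2).
{ eapply Rle_trans; [apply Rabs_triang |]. rewrite Rabs_R1. lra. }
assert (0 <= Cmod (cos y - 1 - y * 0, sin y - 0 - y * 1)) by apply Cmod_ge_0.
assert (Rabs (1 + x) * Cmod (cos y - 1 - y * 0, sin y - 0 - y * 1) <= 2 * (2 * e * m)).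
{ apply Rmult_le_compat; auto. apply Rabs_pos. }
assert (Rabs (x * y) <= e * m).
{ rewrite Rabs_mult. apply Rmult_le_compat; try apply Rabs_pos; lra. }
assert (0 <= m) by apply Cmod_ge_0.
assert (e * Rabs x <= e * m) by nra.
assert (e * m <= eps / 8 * m) by nra.
lra.
Qed.

Lemma Cderiv_exp z : Cderiv Cexp z (Cexp z).
Proof.
apply Cderiv_eps. intros eps He.
assert (P : 0 < Cmod (Cexp z)) by apply Cmod_gt_0, Cexp_neq_0.
destruct (proj1 (Cderiv_eps _ _ _) Cderiv_exp_0 (eps / Cmod (Cexp z))) as [d [Hd H]].
{ now apply Rdiv_lt_0_compat. }
exists d; split; [exact Hd |]. intros w Hw.
specialize (H (w - z)%C). replace (w - z - 0)%C with (w - z)%C in H by ring.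
specialize (H Hw).
replace (Cexp w - Cexp z - (w - z) * Cexp z)%C
  with (Cexp z * (Cexp (w - z) - Cexp 0 - (w - z) * 1))%C.
- rewrite Cmod_mult.
  apply Rle_trans with (Cmod (Cexp z) * (eps / Cmod (Cexp z) * Cmod (w - z))).
  + apply Rmult_le_compat_l; lra.
  + right. field. lra.
- replace (Cexp w) with (Cexp z * Cexp (w - z))%C by (rewrite <- Cexp_plus; f_equal; ring).
  rewrite Cexp_0. ring.
Qed.

Lemma Cdiff_exp z : Cdiff Cexp z.
Proof. eexists. apply Cderiv_exp. Qed.

Definition principal_log (z : C) : C := (ln (Cmod z), atan (Im z / Re z)).

Lemma Cexp_principal_log z : 0 < Re z -> Cexp (principal_log z) = z.
Proof.
intros Hz. destruct z as [x y]. unfold Cexp, principal_log. simpl in *.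
assert (P : 0 < Cmod (x, y)).
{ apply Cmod_gt_0. intros E. apply (f_equal fst) in E. simpl in E. lra. }
rewrite exp_ln by exact P. rewrite cos_atan, sin_atan.
assert (E : sqrt (1 + (y / x) ^ 2) = Cmod (x, y) / x).
{ unfold Cmod; simpl. replace (1 + y / x * (y / x * 1)) with ((x * (x * 1) + y * (y * 1)) / (x * x)).
  - rewrite sqrt_div_alt by nra. rewrite sqrt_square by lra. reflexivity.
  - field. lra. }
rewrite <- !Rsqr_pow2 in E. rewrite E.
apply injective_projections; simpl; field; split; lra.
Qed.

Lemma Ccont_pair (u v : C -> R) z : Ccont (fun w => RtoC (u w)) z ->
  Ccont (fun w => RtoC (v w)) z -> Ccont (fun w => (u w, v w)) z.
Proof.
intros Hu Hv.
apply Ccont_ext_near with (f := fun w => (RtoC (u w) + Ci * RtoC (v w))%C) (d := 1); [lra | |].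
- intros w _. apply injective_projections; simpl; ring.
- apply Ccont_plus; [exact Hu |]. apply Ccont_mult; [apply Ccont_const | exact Hv].
Qed.

Lemma Ccont_principal_log z : 0 < Re z -> Ccont principal_log z.
Proof.
intros Hz. apply Ccont_pair.
- apply (Ccont_real_comp ln Cmod).
  + apply continuity_pt_filterlim, derivable_continuous_pt.
    exists (/ Cmod z). apply derivable_pt_lim_ln. apply Cmod_gt_0.
    intros E. rewrite E in Hz. simpl in Hz. lra.
  + apply Ccont_Cmod, Ccont_id.
- apply (Ccont_real_comp atan (fun w => Im w / Re w)).
  + apply continuity_pt_filterlim, derivable_continuous_pt, derivable_pt_atan.
  + assert (H0 : RtoC (Re z) <> 0) by (intros E; apply (f_equal fst) in E; simpl in E; lra).
    apply Ccont_ext_near with (f := fun w => (RtoC (Im w) / RtoC (Re w))%C) (d := Re z); [exact Hz | |].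
    * intros w Hw. rewrite <- RtoC_div; [reflexivity |].
      assert (L := re_le_Cmod (z - w)). rewrite Cmod_minus_comm in L.
      replace (Re (z - w)%C) with (Re z - Re w) in L by reflexivity.
      apply Rgt_not_eq. generalize (Rle_abs (Re z - Re w)). lra.
    * apply Ccont_div; [apply Ccont_Im, Ccont_id | apply Ccont_Re, Ccont_id | exact H0].
Qed.

(** * Nested rectangles *)

Record rect := Rect { xl : R; xr : R; yl : R; yr : R }.

Definition in_rect (r : rect) (z : C) : Prop :=
  xl r <= fst z <= xr r /\ yl r <= snd z <= yr r.

Definition nonempty_rect (r : rect) : Prop := xl r <= xr r /\ yl r <= yr r.

Definition subrect (r' r : rect) : Prop :=
  xl r <= xl r' /\ xr r' <= xr r /\ yl r <= yl r' /\ yr r' <= yr r.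

Lemma nested_intervals (a b : nat -> R) :
  (forall n, a n <= a (S n)) -> (forall n, b (S n) <= b n) ->
  (forall n, a n <= b n) -> exists x, forall n, a n <= x <= b n.
Proof.
intros Ha Hb Hab.
assert (Ha' : forall n k, a n <= a (k + n)%nat).
{ intros n k; induction k as [| k IH]; simpl; [lra |]. specialize (Ha (k + n)%nat). lra. }
assert (Hb' : forall n k, b (k + n)%nat <= b n).
{ intros n k; induction k as [| k IH]; simpl; [lra |]. specialize (Hb (k + n)%nat). lra. }
assert (H : forall n m, a n <= b m).
{ intros n m. specialize (Ha' n m). specialize (Hb' m n). specialize (Hab (m + n)%nat).
  rewrite Nat.add_comm in Hb'. lra. }
destruct (completeness (fun x => exists n, x = a n)) as [x [Hx1 Hx2]].
- exists (b 0%nat). intros x [n ->]. apply H.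
- exists (a 0%nat). now exists 0%nat.
- exists x. intros n. split.
  + apply Hx1. now exists n.
  + apply Hx2. intros y [m ->]. apply H.
Qed.

(** Dependent choice together with completeness.  [Q n] is the invariant that
    the [n]-th rectangle has to satisfy; the point is only known to lie in all
    the rectangles, which need not shrink.  This serves both Goursat's
    bisection and Baire's theorem. *)
Lemma nested_rectangles (Q : nat -> rect -> Prop) (r0 : rect) :
  Q 0%nat r0 -> (forall n r, Q n r -> nonempty_rect r) ->
  (forall n r, Q n r -> exists r', Q (S n) r' /\ subrect r' r) ->
  exists (u : nat -> rect) (z : C),
    forall n, Q n (u n) /\ in_rect (u n) z /\ subrect (u n) r0.
Proof.
intros H0 Hne Hstep.
set (T := {p : nat * rect | Q (fst p) (snd p)}).
assert (step : forall t : T, {t' : T | fst (proj1_sig t') = S (fst (proj1_sig t)) /\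
   subrect (snd (proj1_sig t')) (snd (proj1_sig t))}).
{ intros [[n r] HQ]. apply constructive_indefinite_description.
  destruct (Hstep n r HQ) as [r' [H1 H2]]. now exists (exist _ (S n, r') H1). }
set (s := fix s n : T := match n with
  | O => exist _ (0%nat, r0) H0 | S n => proj1_sig (step (s n)) end).
assert (Hs : forall n, fst (proj1_sig (s n)) = n).
{ induction n as [| n IH]; [reflexivity |]. simpl.
  destruct (step (s n)) as [t [E E']]. simpl. now rewrite E, IH. }
set (u := fun n => snd (proj1_sig (s n))).
assert (HQ : forall n, Q n (u n)).
{ intros n. generalize (proj2_sig (s n)). now rewrite Hs. }
assert (Hsub : forall n, subrect (u (S n)) (u n)).
{ intros n. unfold u. simpl. now destruct (step (s n)) as [t [E E']]. }
assert (Hsub0 : forall n, subrect (u n) r0).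
{ induction n as [| n IH].
  - unfold u, subrect. simpl. lra.
  - specialize (Hsub n). unfold subrect in *. lra. }
destruct (nested_intervals (fun n => xl (u n)) (fun n => xr (u n))) as [x Hx];
  try (intros n; apply Hsub). { intros n. apply (Hne n _ (HQ n)). }
destruct (nested_intervals (fun n => yl (u n)) (fun n => yr (u n))) as [y Hy];
  try (intros n; apply Hsub). { intros n. apply (Hne n _ (HQ n)). }
exists u, (x, y). intros n. repeat split; simpl; try apply HQ; try apply Hx;
  try apply Hy; apply Hsub0.
Qed.

Lemma halving_small (W d : R) : 0 < d -> exists N : nat, forall n, (N <= n)%nat -> W / 2 ^ n < d.
Proof.
intros Hd.
destruct (pow_lt_1_zero (/ 2)) with (y := d / (Rabs W + 1)) as [N HN].
- rewrite Rabs_pos_eq; lra.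
- apply Rdiv_lt_0_compat; [exact Hd |]. generalize (Rabs_pos W). lra.
- exists N. intros n Hn. specialize (HN n Hn).
  assert (P : 0 < (/ 2) ^ n) by (apply pow_lt; lra).
  rewrite Rabs_pos_eq in HN by lra.
  unfold Rdiv. rewrite <- pow_inv.
  assert (Q : 0 < Rabs W + 1) by (generalize (Rabs_pos W); lra).
  apply Rmult_lt_compat_r with (r := Rabs W + 1) in HN; [| exact Q].
  unfold Rdiv in HN. rewrite Rmult_assoc, Rinv_l in HN by lra.
  generalize (Rle_abs W). nra.
Qed.

(** Cousin's lemma with tags: a property that passes from the pieces of a
    rectangle to the rectangle needs to be checked only on small rectangles
    around each point.  It is essential for Goursat that the small rectangle
    contain the point, and that it have the proportions of [r0] (third
    equation), so that its area controls the square of its diameter. *)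
Lemma rect_bisection (P : rect -> Prop) (r0 : rect) : nonempty_rect r0 ->
  (forall r x y, nonempty_rect r -> subrect r r0 ->
     xl r <= x <= xr r -> yl r <= y <= yr r ->
     P (Rect (xl r) x (yl r) y) -> P (Rect x (xr r) (yl r) y) ->
     P (Rect (xl r) x y (yr r)) -> P (Rect x (xr r) y (yr r)) -> P r) ->
  (forall z, in_rect r0 z -> exists d, 0 < d /\ forall r,
     subrect r r0 -> nonempty_rect r -> in_rect r z ->
     (xr r - xl r) * (yr r0 - yl r0) = (yr r - yl r) * (xr r0 - xl r0) ->
     xr r - xl r < d -> yr r - yl r < d -> P r) -> P r0.
Proof.
intros Hne Hadd Hloc. apply NNPP. intros Hbad.
set (W := xr r0 - xl r0). set (H := yr r0 - yl r0).
set (Q := fun (n : nat) r => ~ P r /\ xr r - xl r = W / 2 ^ n /\ yr r - yl r = H / 2 ^ n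
   /\ nonempty_rect r /\ subrect r r0).
destruct (nested_rectangles Q r0) as [u [z Hu]].
- unfold Q. repeat split; try lra; auto; try apply Hne; unfold W, H; simpl; field.
- intros n r [_ [_ [_ [HH _]]]]. exact HH.
- intros n r [Hr [Hw [Hh [Hn Hs]]]].
  set (x := (xl r + xr r) / 2). set (y := (yl r + yr r) / 2).
  assert (E : forall K, K / 2 ^ (S n) = K / 2 ^ n / 2).
  { intros K. simpl. field. apply pow_nonzero. lra. }
  destruct Hn as [Hnx Hny].
  apply NNPP. intros Hno. apply Hr.
  apply (Hadd r x y); auto; [now split | unfold x; lra | unfold y; lra | | | |];
    apply NNPP; intros Hq; apply Hno; eexists; (split; [split; [exact Hq |] |]);
    unfold subrect, nonempty_rect in *; simpl xl; simpl xr; simpl yl; simpl yr;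
    rewrite ?E, <- ?Hw, <- ?Hh; unfold x, y; lra.
- assert (Hz : in_rect r0 z).
  { destruct (Hu 0%nat) as [_ [Hz Hs]]. unfold in_rect, subrect in *. lra. }
  destruct (Hloc z Hz) as [d [Hd Hl]].
  destruct (halving_small W d Hd) as [N1 HN1].
  destruct (halving_small H d Hd) as [N2 HN2].
  set (n := (N1 + N2)%nat).
  destruct (Hu n) as [[Hp [Hw [Hh [Hn _]]]] [Hzn Hs]].
  apply Hp, Hl; auto.
  + rewrite Hw, Hh. fold W H. field. apply pow_nonzero. lra.
  + rewrite Hw. apply HN1. lia.
  + rewrite Hh. apply HN2. lia.
Qed.

(** * Goursat and the mean value property *)

Notation CRInt := (RInt (V := C_R_CompleteNormedModule)).
Notation is_CRInt := (is_RInt (V := C_R_NormedModule)).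

(** The contour integral of [F] along [t |-> z + t v], for [a <= t <= b]. *)
Definition line_int (F : C -> C) (z v : C) (a b : R) : C :=
  (v * CRInt (fun t => F (z + t * v)%C) a b)%C.

Lemma Ccont_path (F : C -> C) (g : R -> C) t : Ccont F (g t) ->
  (forall s, Cmod (g s - g t) <= Rabs (s - t)) ->
  continuous (T := R_UniformSpace) (U := C_UniformSpace) (fun s => F (g s)) t.
Proof.
intros HF Hg P [e He].
destruct (proj1 (Ccont_eps _ _) HF e (cond_pos e)) as [d [Hd H]].
exists (mkposreal d Hd). intros s Hs. apply He.
apply C_NormedModule_mixin_compat1. apply H.
eapply Rle_lt_trans; [apply Hg | exact Hs].
Qed.

Lemma line_lipschitz z v s t : Cmod v <= 1 ->
  Cmod (z + RtoC s * v - (z + RtoC t * v)) <= Rabs (s - t).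
Proof.
intros Hv. replace (z + RtoC s * v - (z + RtoC t * v))%C with (RtoC (s - t) * v)%C
  by (rewrite RtoC_minus; ring).
rewrite Cmod_mult, Cmod_R. generalize (Rabs_pos (s - t)). nra.
Qed.

Lemma ex_line_int (F : C -> C) (z v : C) a b : Cmod v <= 1 -> a <= b ->
  (forall t, a <= t <= b -> Ccont F (z + RtoC t * v)) ->
  ex_RInt (V := C_R_CompleteNormedModule) (fun t => F (z + t * v)%C) a b.
Proof.
intros Hv Hab H. apply ex_RInt_continuous. intros t Ht.
rewrite Rmin_left, Rmax_right in Ht by exact Hab.
apply Ccont_path; [now apply H |]. intros s. now apply line_lipschitz.
Qed.

Lemma line_int_chasles (F : C -> C) (z v : C) a m b : Cmod v <= 1 -> a <= m <= b ->
  (forall t, a <= t <= b -> Ccont F (z + RtoC t * v)) ->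
  line_int F z v a b = (line_int F z v a m + line_int F z v m b)%C.
Proof.
intros Hv Hm H. unfold line_int. rewrite <- Cmult_plus_distr_l. f_equal. symmetry.
apply (RInt_Chasles (V := C_R_CompleteNormedModule)); apply ex_line_int; try lra;
  intros; apply H; lra.
Qed.

Lemma is_derive_path (G : C -> C) (g : R -> C) (v l : C) t :
  (forall s, g s - g t = RtoC (s - t) * v)%C -> Cderiv G (g t) l ->
  is_derive (K := R_AbsRing) (V := C_R_NormedModule) (fun s => G (g s)) t (v * l)%C.
Proof.
intros Hg HG. split.
{ exact (is_linear_scal_l (K := R_AbsRing) (V := C_R_NormedModule) (v * l)%C). }
intros x Hx e.
assert (E : t = x) by exact (is_filter_lim_locally_unique (K := R_AbsRing)
                               (V := R_NormedModule) t x Hx).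
subst x.
assert (P := Cmod_ge_0 v).
destruct (proj1 (Cderiv_eps _ _ _) HG (e / (Cmod v + 1))) as [d [Hd H]].
{ apply Rdiv_lt_0_compat; [apply cond_pos | lra]. }
assert (Hd' : 0 < d / (Cmod v + 1)) by (apply Rdiv_lt_0_compat; lra).
exists (mkposreal _ Hd'). intros s Hs.
change (Rabs (s - t) < d / (Cmod v + 1)) in Hs.
change (norm (K := R_AbsRing) (V := R_NormedModule) (minus s t)) with (Rabs (s - t)).
change (norm (K := R_AbsRing) (V := C_R_NormedModule)
  (minus (minus (G (g s)) (G (g t))) (scal (s - t) (v * l)%C)) <= e * Rabs (s - t)).
rewrite scal_R_Cmult.
change (norm (K := R_AbsRing) (V := C_R_NormedModule)
  (G (g s) - G (g t) - RtoC (s - t) * (v * l))%C <= e * Rabs (s - t)).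
rewrite <- Cmod_norm.
assert (M : Cmod (g s - g t) = Rabs (s - t) * Cmod v) by now rewrite Hg, Cmod_mult, Cmod_R.
specialize (H (g s)). rewrite M in H.
assert (Q := Rabs_pos (s - t)).
replace (RtoC (s - t) * (v * l))%C with ((g s - g t) * l)%C by (rewrite Hg; ring).
assert (B : Rabs (s - t) * (Cmod v + 1) < d).
{ apply Rmult_lt_compat_r with (r := Cmod v + 1) in Hs; [| lra].
  unfold Rdiv in Hs. now rewrite Rmult_assoc, Rinv_l, Rmult_1_r in Hs by lra. }
eapply Rle_trans; [apply H; nra |].
assert (D : e / (Cmod v + 1) * (Cmod v + 1) = e) by (field; lra).
assert (0 < e / (Cmod v + 1)) by (apply Rdiv_lt_0_compat; [apply cond_pos | lra]).
nra.
Qed.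

Lemma Cderiv_quadratic (p q z : C) : Cderiv (fun w => p * w + q * w * w / 2)%C z (p + q * z)%C.
Proof.
apply Cderiv_eps. intros eps He.
assert (P := Cmod_ge_0 q).
exists (eps / (Cmod q + 1)); split; [apply Rdiv_lt_0_compat; lra |].
intros w Hw.
replace (p * w + q * w * w / 2 - (p * z + q * z * z / 2) - (w - z) * (p + q * z))%C
  with (q * / RtoC 2 * (w - z) * (w - z))%C by (field; intros E; apply (f_equal fst) in E; simpl in E; lra).
rewrite !Cmod_mult. apply Rmult_le_compat_r; [apply Cmod_ge_0 |].
assert (T : Cmod (/ RtoC 2) = / 2).
{ rewrite <- RtoC_inv by lra. rewrite Cmod_R, Rabs_pos_eq; lra. }
rewrite T. assert (Q := Cmod_ge_0 (w - z)).
apply Rmult_lt_compat_r with (r := Cmod q + 1) in Hw; [| lra].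
unfold Rdiv in Hw. rewrite Rmult_assoc, Rinv_l, Rmult_1_r in Hw by lra. nra.
Qed.

(** An affine function has the primitive [G], so its integral is an increment of
    [G]; what remains is bounded by length times [e]. *)
Lemma line_int_near_affine (F : C -> C) (p q z v : C) a b e : Cmod v = 1 -> a <= b ->
  (forall t, a <= t <= b -> Ccont F (z + RtoC t * v)) ->
  (forall t, a <= t <= b ->
     Cmod (F (z + RtoC t * v)%C - (p + q * (z + RtoC t * v)))%C <= e) ->
  let G := (fun w => p * w + q * w * w / 2)%C in
  Cmod (line_int F z v a b - (G (z + RtoC b * v) - G (z + RtoC a * v)))%C <= (b - a) * e.
Proof.
intros Hv Hab HF HE G.
set (g := fun t : R => (z + RtoC t * v)%C).
assert (Hg : forall t s, (g s - g t = RtoC (s - t) * v)%C).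
{ intros t s. unfold g. rewrite RtoC_minus. ring. }
assert (I1 : is_CRInt (fun t => F (g t)) a b (CRInt (fun t => F (g t)) a b)).
{ apply (RInt_correct (V := C_R_CompleteNormedModule)), ex_line_int; auto. lra. }
assert (I2 : is_CRInt (fun t => (p + q * g t)%C) a b ((G (g b) - G (g a)) / v)%C).
{ assert (Hv0 : v <> 0) by (apply Cmod_gt_0; lra).
  replace ((G (g b) - G (g a)) / v)%C with
    (minus (G := C_R_CompleteNormedModule) (G (g b) / v)%C (G (g a) / v)%C)
    by (change ((G (g b) / v - G (g a) / v)%C = ((G (g b) - G (g a)) / v)%C); field; auto).
  set (G' := fun w => (p / v * w + q / v * w * w / 2)%C).
  assert (EG : forall w, (G w / v = G' w)%C).
  { intros w. unfold G, G'. field; auto. }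
  rewrite !EG.
  apply (is_RInt_derive (V := C_R_CompleteNormedModule) (fun t => G' (g t))).
  - intros t _. replace (p + q * g t)%C with (v * (p / v + q / v * g t))%C by (field; auto).
    apply is_derive_path; [intros s; apply Hg |]. apply Cderiv_quadratic.
  - intros t _. apply (Ccont_path (fun w => (p + q * w)%C)).
    + apply Ccont_plus; [apply Ccont_const |]. apply Ccont_mult; [apply Ccont_const | apply Ccont_id].
    + intros s. apply line_lipschitz. lra. }
assert (I3 := is_RInt_minus (V := C_R_NormedModule) _ _ _ _ _ _ I1 I2).
assert (I4 := is_RInt_const (V := R_NormedModule) a b e).
assert (B := norm_RInt_le (V := C_R_NormedModule) _ _ a b _ _ Hab
   (fun t Ht => eq_ind _ (fun x => x <= e) (HE t Ht) _ (Cmod_norm _)) I3 I4).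
change (norm (K := R_AbsRing) (V := C_R_NormedModule)
  (CRInt (fun t => F (g t)) a b - (G (g b) - G (g a)) / v)%C <= (b - a) * e) in B.
rewrite <- Cmod_norm in B.
replace (line_int F z v a b - _)%C
  with (v * (CRInt (fun t => F (g t)) a b - (G (g b) - G (g a)) / v))%C.
- rewrite Cmod_mult, Hv. lra.
- unfold line_int. fold (g a) (g b). change (fun t => F (g t)) with (fun t : R => F (z + t * v)%C).
  field. apply Cmod_gt_0. lra.
Qed.

Definition boundary_int (F : C -> C) (r : rect) : C :=
  (line_int F (Ci * yl r) 1 (xl r) (xr r) + line_int F (xr r) Ci (yl r) (yr r)
   - line_int F (Ci * yr r) 1 (xl r) (xr r) - line_int F (xl r) Ci (yl r) (yr r))%C.

Lemma horizontal_pt x y : (Ci * RtoC y + RtoC x * 1)%C = (x, y).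
Proof. apply injective_projections; simpl; ring. Qed.

Lemma vertical_pt x y : (RtoC x + RtoC y * Ci)%C = (x, y).
Proof. apply injective_projections; simpl; ring. Qed.

Lemma boundary_int_split (F : C -> C) r x y : xl r <= x <= xr r -> yl r <= y <= yr r ->
  (forall z, in_rect r z -> Ccont F z) ->
  boundary_int F r = (boundary_int F (Rect (xl r) x (yl r) y) + boundary_int F (Rect x (xr r) (yl r) y)
    + boundary_int F (Rect (xl r) x y (yr r)) + boundary_int F (Rect x (xr r) y (yr r)))%C.
Proof.
intros Hx Hy Hc. unfold boundary_int. simpl.
assert (M1 : Cmod 1 <= 1) by (rewrite Cmod_1; lra).
assert (M2 : Cmod Ci <= 1) by (rewrite Cmod_Ci; lra).
rewrite (line_int_chasles F _ _ (xl r) x (xr r) M1 Hx).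
2: { intros t Ht. rewrite horizontal_pt. apply Hc. split; simpl; lra. }
rewrite (line_int_chasles F (Ci * yr r) _ (xl r) x (xr r) M1 Hx).
2: { intros t Ht. rewrite horizontal_pt. apply Hc. split; simpl; lra. }
rewrite (line_int_chasles F _ _ (yl r) y (yr r) M2 Hy).
2: { intros t Ht. rewrite vertical_pt. apply Hc. split; simpl; lra. }
rewrite (line_int_chasles F (xl r) _ (yl r) y (yr r) M2 Hy).
2: { intros t Ht. rewrite vertical_pt. apply Hc. split; simpl; lra. }
ring.
Qed.

Lemma in_rect_dist r z w : in_rect r z -> in_rect r w ->
  Cmod (w - z) <= (xr r - xl r) + (yr r - yl r).
Proof.
destruct z as [x y], w as [x' y']. unfold in_rect; simpl. intros H H'.
change ((x', y') - (x, y))%C with (x' - x, y' - y).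
eapply Rle_trans; [apply Cmod_le_abs |].
apply Rplus_le_compat; apply Rabs_le; lra.
Qed.

(** The increments of the primitive over the four sides add up to 0. *)
Lemma boundary_int_near_affine (F : C -> C) (p q : C) r e : nonempty_rect r ->
  (forall z, in_rect r z -> Ccont F z) ->
  (forall z, in_rect r z -> Cmod (F z - (p + q * z)) <= e) ->
  Cmod (boundary_int F r) <= 2 * ((xr r - xl r) + (yr r - yl r)) * e.
Proof.
intros [Hx Hy] Hc He.
set (G := (fun w => p * w + q * w * w / 2)%C).
assert (A : forall y, yl r <= y <= yr r ->
  Cmod (line_int F (Ci * y) 1 (xl r) (xr r) - (G (xr r, y) - G (xl r, y)))%C <= (xr r - xl r) * e).
{ intros y Hy'. rewrite <- !horizontal_pt.
  apply (line_int_near_affine F p q); [apply Cmod_1 | exact Hx | |];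
    intros t Ht; rewrite horizontal_pt; [apply Hc | apply He]; now split. }
assert (B : forall x, xl r <= x <= xr r ->
  Cmod (line_int F x Ci (yl r) (yr r) - (G (x, yr r) - G (x, yl r)))%C <= (yr r - yl r) * e).
{ intros x Hx'. rewrite <- !vertical_pt.
  apply (line_int_near_affine F p q); [apply Cmod_Ci | exact Hy | |];
    intros t Ht; rewrite vertical_pt; [apply Hc | apply He]; now split. }
assert (A1 := A (yl r)). assert (A2 := A (yr r)).
assert (B1 := B (xl r)). assert (B2 := B (xr r)).
set (a1 := (line_int F (Ci * yl r) 1 (xl r) (xr r) - (G (xr r, yl r) - G (xl r, yl r)))%C) in *.
set (a2 := (line_int F (Ci * yr r) 1 (xl r) (xr r) - (G (xr r, yr r) - G (xl r, yr r)))%C) in *.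
set (b1 := (line_int F (xl r) Ci (yl r) (yr r) - (G (xl r, yr r) - G (xl r, yl r)))%C) in *.
set (b2 := (line_int F (xr r) Ci (yl r) (yr r) - (G (xr r, yr r) - G (xr r, yl r)))%C) in *.
replace (boundary_int F r) with (a1 + b2 + (- a2) + (- b1))%C
  by (unfold boundary_int, a1, a2, b1, b2; ring).
eapply Rle_trans; [apply Cmod_triangle |].
eapply Rle_trans; [apply Rplus_le_compat_r, Cmod_triangle |].
eapply Rle_trans; [apply Rplus_le_compat_r, Rplus_le_compat_r, Cmod_triangle |].
rewrite !Cmod_opp. lra.
Qed.

(** Near a point of differentiability [F] is affine up to [e] times the
    diameter, so the integral over the boundary of a small rectangle is at most
    [e] times the square of its perimeter, hence an arbitrarily small multiple
    of its area.  Such a bound is additive and so passes to [r0]. *)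
Lemma goursat (F : C -> C) r0 : xl r0 < xr r0 -> yl r0 < yr r0 ->
  (forall z, in_rect r0 z -> Cdiff F z) -> boundary_int F r0 = 0.
Proof.
intros HW HH HF.
assert (Hc : forall r, subrect r r0 -> forall z, in_rect r z -> Ccont F z).
{ intros r Hr z Hz. apply Cdiff_cont, HF. unfold in_rect, subrect in *. lra. }
set (W := xr r0 - xl r0). set (H := yr r0 - yl r0).
assert (HW' : 0 < W) by (unfold W; lra). assert (HH' : 0 < H) by (unfold H; lra).
assert (K : forall eta, 0 < eta -> Cmod (boundary_int F r0) <= eta * (W * H)).
{ intros eta Heta.
  apply (rect_bisection (fun r => Cmod (boundary_int F r) <= eta * ((xr r - xl r) * (yr r - yl r))) r0).
  - split; lra.
  - intros r x y Hne Hs Hx Hy. simpl. intros P1 P2 P3 P4.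
    rewrite (boundary_int_split F r x y Hx Hy (Hc r Hs)).
    eapply Rle_trans; [apply Cmod_triangle |].
    eapply Rle_trans; [apply Rplus_le_compat_r, Cmod_triangle |].
    eapply Rle_trans; [apply Rplus_le_compat_r, Rplus_le_compat_r, Cmod_triangle |].
    lra.
  - intros z Hz. destruct (HF z Hz) as [l Hl].
    (* A rectangle with sides [w = k W] and [h = k H] gets the bound
       [2 (w + h) e (w + h)], and [e] is such that this is [eta w h]. *)
    set (e := eta * (W * H) / (2 * (W + H) ^ 2)).
    assert (He : 0 < e).
    { apply Rdiv_lt_0_compat; [apply Rmult_lt_0_compat; nra | nra]. }
    destruct (proj1 (Cderiv_eps _ _ _) Hl e He) as [d [Hd HD]].
    exists (d / 2); split; [lra |]. intros r Hs Hn Hzr Hasp Hw Hh.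
    fold W H in Hasp.
    set (w := xr r - xl r) in *. set (h := yr r - yl r) in *.
    eapply Rle_trans.
    + apply (boundary_int_near_affine F (F z - l * z) l r (e * (w + h)) Hn (Hc r Hs)).
      intros u Hu. replace (F u - (F z - l * z + l * u))%C with (F u - F z - (u - z) * l)%C by ring.
      assert (D := in_rect_dist r z u Hzr Hu). fold w h in D.
      eapply Rle_trans; [apply HD; lra |]. apply Rmult_le_compat_l; lra.
    + fold w h. right.
      assert (Eh : h = w / W * H). { apply Rmult_eq_reg_r with W; [| lra]. rewrite <- Hasp. field. lra. }
      rewrite Eh. unfold e. field. split; nra. }
apply Cmod_eq_0. apply Rle_antisym; [| apply Cmod_ge_0].
apply Rnot_lt_le. intros P.
assert (P2 : 0 < W * H) by now apply Rmult_lt_0_compat.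
specialize (K (Cmod (boundary_int F r0) / (2 * (W * H)))).
assert (Q : Cmod (boundary_int F r0) / (2 * (W * H)) * (W * H) = Cmod (boundary_int F r0) / 2) by (field; lra).
rewrite Q in K. assert (0 < Cmod (boundary_int F r0) / (2 * (W * H))) by (apply Rdiv_lt_0_compat; lra).
specialize (K H0). lra.
Qed.

(** The function [w |-> f (p + exp w)] has period [2 PI i], so the horizontal
    sides of [[x, rho] * [0, 2 PI]] contribute opposite amounts to Goursat's
    integral and the integral over the vertical sides does not depend on [x].
    As [x] goes to minus infinity it tends to [2 PI f p].  At [p] only
    continuity is assumed, so that the lemma applies at removable
    singularities. *)
Lemma mean_value (f : C -> C) (p : C) (r rho : R) :
  (forall z, 0 < Cmod (z - p) < r -> Cdiff f z) -> Ccont f p -> exp rho < r ->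
  is_CRInt (fun th => f (p + Cexp (RtoC rho + RtoC th * Ci))%C) 0 (2 * PI) (2 * PI * f p)%C.
Proof.
intros Hf Hp Hrho.
set (F := fun w => f (p + Cexp w)%C).
assert (HF : forall z, Re z <= rho -> Cdiff F z).
{ intros z Hz. apply (Cdiff_comp f (fun w => p + Cexp w)%C).
  - apply Hf. replace (p + Cexp z - p)%C with (Cexp z) by ring. rewrite Cmod_Cexp.
    split; [apply exp_pos |]. destruct Hz as [Hz | ->]; [apply exp_increasing in Hz; lra | lra].
  - apply Cdiff_plus; [apply Cdiff_const | apply Cdiff_exp]. }
assert (Pi := PI_RGT_0).
assert (M2 : Cmod Ci <= 1) by (rewrite Cmod_Ci; lra).
set (I := fun x : R => CRInt (fun th => F (RtoC x + RtoC th * Ci)%C) 0 (2 * PI)).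
assert (HI : forall x, x <= rho -> is_CRInt (fun th => F (RtoC x + RtoC th * Ci)%C) 0 (2 * PI) (I x)).
{ intros x Hx. apply (RInt_correct (V := C_R_CompleteNormedModule)).
  apply ex_line_int; [exact M2 | lra |]. intros t _. rewrite vertical_pt. now apply Cdiff_cont, HF. }
assert (Hconst : forall x, x < rho -> I x = I rho).
{ intros x Hx.
  assert (G := goursat F (Rect x rho 0 (2 * PI))). simpl in G. specialize (G Hx ltac:(lra)).
  assert (G0 : boundary_int F (Rect x rho 0 (2 * PI)) = 0).
  { apply G. intros z [Hz _]. apply HF. apply Hz. }
  unfold boundary_int in G0; simpl in G0.
  assert (E : line_int F (Ci * RtoC (2 * PI)) 1 x rho = line_int F (Ci * RtoC 0) 1 x rho).
  { unfold line_int. f_equal. apply RInt_ext. intros t _. unfold F. do 2 f_equal.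
    rewrite !horizontal_pt. unfold Cexp; simpl. now rewrite cos_2PI, sin_2PI, cos_0, sin_0. }
  rewrite E in G0. unfold line_int in G0 at 2 4. fold (I x) (I rho) in G0.
  assert (G1 : (Ci * (I rho - I x) = 0)%C) by (rewrite <- G0; ring).
  apply (f_equal Cmod) in G1. rewrite Cmod_mult, Cmod_Ci, Cmod_0, Rmult_1_l in G1.
  apply Cmod_eq_0 in G1. symmetry. now apply Ceq_minus. }
replace (2 * PI * f p)%C with (I rho); [now apply HI, Rle_refl |].
apply Ceq_minus, Cmod_eq_0, Rle_antisym; [| apply Cmod_ge_0].
apply Rnot_lt_le. intros P. set (m := Cmod (I rho - 2 * PI * f p)) in *.
destruct (proj1 (Ccont_eps _ _) Hp (m / (4 * PI))) as [d [Hd HD]].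
{ apply Rdiv_lt_0_compat; lra. }
(* Any [x < rho] with [exp x < d] will do. *)
set (x := Rmin (rho - 1) (ln (d / 2))).
assert (Hx1 : x < rho). { unfold x. generalize (Rmin_l (rho - 1) (ln (d / 2))). lra. }
assert (Hx2 : exp x < d).
{ apply Rle_lt_trans with (exp (ln (d / 2))).
  - destruct (Rmin_r (rho - 1) (ln (d / 2))) as [L | L]; fold x in L.
    + apply exp_increasing in L. lra. + rewrite L. lra.
  - rewrite exp_ln; lra. }
assert (I1 := HI x (Rlt_le _ _ Hx1)).
assert (I2 := is_RInt_const (V := C_R_NormedModule) 0 (2 * PI) (f p)).
assert (I3 := is_RInt_minus (V := C_R_NormedModule) _ _ _ _ _ _ I1 I2).
assert (I4 := is_RInt_const (V := R_NormedModule) 0 (2 * PI) (m / (4 * PI))).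
assert (B : norm (K := R_AbsRing) (V := C_R_NormedModule)
  (minus (I x) (scal (2 * PI - 0) (f p))) <= scal (2 * PI - 0) (m / (4 * PI))).
{ refine (norm_RInt_le (V := C_R_NormedModule) _ _ 0 (2 * PI) _ _ _ _ I3 I4); [lra |].
  intros t _.
  change (norm (K := R_AbsRing) (V := C_R_NormedModule)
    (F (RtoC x + RtoC t * Ci) - f p)%C <= m / (4 * PI)).
  rewrite <- Cmod_norm. apply Rlt_le, HD.
  replace (p + Cexp (x + t * Ci) - p)%C with (Cexp (x + t * Ci))%C by ring.
  rewrite Cmod_Cexp, vertical_pt. exact Hx2. }
rewrite scal_R_Cmult in B.
change (norm (K := R_AbsRing) (V := C_R_NormedModule)
    (I x - RtoC (2 * PI - 0) * f p)%C <= (2 * PI - 0) * (m / (4 * PI))) in B.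
rewrite <- Cmod_norm, Hconst in B by exact Hx1.
rewrite Rminus_0_r, RtoC_mult in B. fold m in B.
replace (2 * PI * (m / (4 * PI))) with (m / 2) in B by (field; lra). lra.
Qed.

(** * Compactness of closed disks *)

(** A Lebesgue number for the cover by the balls of radius [delta u].  The disk
    is put into a square, where points outside the disk get balls that miss it. *)
Lemma disc_gauge (R0 : R) (delta : C -> R) : (forall z, Cmod z <= R0 -> 0 < delta z) ->
  exists d, 0 < d /\ forall z, Cmod z <= R0 ->
    exists u, Cmod u <= R0 /\ Cmod (z - u) < delta u /\ d <= delta u.
Proof.
intros Hd.
set (g := fun u : C => if Rle_dec (Cmod u) R0 then delta u / 2 else (Cmod u - R0) / 2).
assert (Hg : forall u, 0 < g u).
{ intros u. unfold g. destruct (Rle_dec (Cmod u) R0) as [H | H]; [specialize (Hd u H) |]; lra. }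
destruct (compactness_value_2d (- R0) R0 (- R0) R0 (fun x y => mkposreal _ (Hg (x, y)))) as [d H].
exists d; split; [apply cond_pos |].
intros [x y] Hz. apply NNPP. intros Hno.
assert (Hx := re_le_Cmod (x, y)). assert (Hy := im_le_Cmod (x, y)). simpl in Hx, Hy.
apply Rle_trans with (2 := Hz) in Hx, Hy. apply Rabs_le_between in Hx, Hy.
apply (H x y Hx Hy). intros (u & v & _ & _ & H1 & H2 & H3). simpl in H1, H2, H3.
assert (D : Cmod ((x, y) - (u, v)) < 2 * g (u, v)).
{ change ((x, y) - (u, v))%C with (x - u, y - v).
  eapply Rle_lt_trans; [apply Cmod_le_abs | lra]. }
unfold g in D, H3. destruct (Rle_dec (Cmod (u, v)) R0) as [L | L].
- apply Hno. exists (u, v). specialize (Hd _ L). repeat split; lra.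
- generalize (Cmod_triangle_rev (u, v) (x, y)). rewrite Cmod_minus_comm. lra.
Qed.

Lemma Ccont_bounded (f : C -> C) R0 : (forall z, Cmod z <= R0 -> Ccont f z) ->
  exists M, 0 < M /\ forall z, Cmod z <= R0 -> Cmod (f z) <= M.
Proof.
intros Hf.
assert (E : forall u, exists d, Cmod u <= R0 -> 0 < d /\ d <= / (Cmod (f u) + 1) /\
   forall w, Cmod (w - u) < d -> Cmod (f w - f u) < 1).
{ intros u. destruct (Rle_dec (Cmod u) R0) as [H | H]; [| now exists 0].
  destruct (proj1 (Ccont_eps _ _) (Hf u H) 1 Rlt_0_1) as [d [Hd H1]].
  (* Making the radius small where [f] is large lets the Lebesgue number bound [f]. *)
  exists (Rmin d (/ (Cmod (f u) + 1))). intros _.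
  assert (P := Cmod_ge_0 (f u)).
  split; [apply Rmin_glb_lt; [exact Hd | apply Rinv_0_lt_compat; lra] |].
  split; [apply Rmin_r |]. intros w Hw. apply H1.
  eapply Rlt_le_trans; [exact Hw | apply Rmin_l]. }
set (delta := fun u => proj1_sig (constructive_indefinite_description _ (E u))).
assert (Hdelta := fun u => proj2_sig (constructive_indefinite_description _ (E u))).
fold delta in Hdelta.
destruct (disc_gauge R0 delta) as [d [Hd H]].
{ intros z Hz. now apply (Hdelta z). }
exists (/ d). split; [now apply Rinv_0_lt_compat |]. intros z Hz.
destruct (H z Hz) as (u & Hu & H1 & H2).
destruct (Hdelta u Hu) as [_ [H3 H4]]. specialize (H4 z H1).
change (delta u <= / (Cmod (f u) + 1)) in H3.
assert (P := Cmod_ge_0 (f u)).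
assert (Cmod (f u) + 1 <= / d).
{ rewrite <- (Rinv_inv (Cmod (f u) + 1)). apply Rinv_le_contravar; lra. }
generalize (Cmod_triangle_rev (f z) (f u)). lra.
Qed.

Lemma Ccont_attains_max (u : C -> R) R0 : 0 <= R0 ->
  (forall z, Cmod z <= R0 -> Ccont (fun w => RtoC (u w)) z) ->
  exists p, Cmod p <= R0 /\ forall z, Cmod z <= R0 -> u z <= u p.
Proof.
intros HR Hu.
destruct (Ccont_bounded _ R0 Hu) as [M [_ HM]].
destruct (completeness (fun x => exists z, Cmod z <= R0 /\ x = u z)) as [m [Hm1 Hm2]].
- exists M. intros x [z [Hz ->]]. specialize (HM z Hz). rewrite Cmod_R in HM.
  generalize (Rle_abs (u z)). lra.
- exists (u 0), 0. now rewrite Cmod_0.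
- apply NNPP. intros Hno.
  assert (Hlt : forall z, Cmod z <= R0 -> u z < m).
  { intros z Hz. destruct (Rle_lt_or_eq_dec (u z) m) as [L | L]; auto.
    - apply Hm1. now exists z.
    - exfalso. apply Hno. exists z; split; [exact Hz |]. intros w Hw.
      rewrite L. apply Hm1. now exists w. }
  (* If the supremum [m] is not attained, [1 / (m - u)] is continuous, hence
     bounded, and the supremum is smaller than [m]. *)
  destruct (Ccont_bounded (fun w => 1 / (RtoC m - RtoC (u w)))%C R0) as [K [HK0 HK]].
  { intros z Hz. apply Ccont_div; [apply Ccont_const | |].
    - apply Ccont_minus; [apply Ccont_const | now apply Hu].
    - rewrite <- RtoC_minus. intros E. apply (f_equal fst) in E. simpl in E.
      specialize (Hlt z Hz). lra. }
  assert (m <= m - / K).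
  { apply Hm2. intros x [z [Hz ->]]. specialize (HK z Hz). specialize (Hlt z Hz).
    rewrite <- RtoC_minus, <- RtoC_div, Cmod_R, Rabs_pos_eq in HK.
    - assert (/ K <= m - u z); [| lra].
      rewrite <- (Rinv_inv (m - u z)). apply Rinv_le_contravar.
      + apply Rinv_0_lt_compat; lra. + lra.
    - apply Rlt_le, Rdiv_lt_0_compat; lra.
    - lra. }
  assert (0 < / K) by now apply Rinv_0_lt_compat. lra.
Qed.

(** * Maximum principle, Schwarz lemma, identity theorem *)

Lemma is_RInt_trig (k q a b : R) :
  is_RInt (fun th => k - q * (a * cos th + b * sin th)) 0 (2 * PI) (2 * PI * k).
Proof.
set (G := fun th => k * th - q * (a * sin th - b * cos th)).
replace (2 * PI * k) with (minus (G (2 * PI)) (G 0)).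
- apply (is_RInt_derive (V := R_CompleteNormedModule)).
  + intros x _. unfold G. auto_derive; auto. ring.
  + intros x _. apply (ex_derive_continuous (K := R_AbsRing) (V := R_NormedModule)).
    auto_derive. auto.
- unfold minus, plus, opp, G; simpl. rewrite sin_2PI, cos_2PI, sin_0, cos_0. ring.
Qed.

(** After a rotation, a value of modulus [m > M] at [z0] becomes a value of
    [Re (c f)].  Adding [e |z|^2] makes the mean value inequality strict: at an
    interior maximum [p] of [Re (c f) + e |z|^2], averaging over a circle of
    radius [s] would give [Re (c f p) <= Re (c f p) - e s^2].  At 0 only
    continuity is assumed, since [schwarz] has a removable singularity there. *)
Lemma max_modulus (f : C -> C) (R0 M : R) : 0 < R0 ->
  (forall z, Cmod z <= R0 -> Ccont f z) ->
  (forall z, 0 < Cmod z < R0 -> Cdiff f z) ->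
  (forall z, Cmod z = R0 -> Cmod (f z) <= M) ->
  forall z, Cmod z <= R0 -> Cmod (f z) <= M.
Proof.
intros HR Hc Hd HM z0 Hz0. apply Rnot_lt_le. intros Hlt.
assert (HM0 : 0 <= M).
{ eapply Rle_trans; [apply Cmod_ge_0 | apply (HM (RtoC R0))].
  rewrite Cmod_R. apply Rabs_pos_eq. lra. }
set (m := Cmod (f z0)) in *.
set (c := (Cconj (f z0) / RtoC m)%C).
assert (Hm0 : RtoC m <> 0) by (intros E; apply (f_equal fst) in E; simpl in E; lra).
assert (Hc1 : Cmod c = 1).
{ unfold c. rewrite Cmod_div, Cmod_conj, Cmod_R, Rabs_pos_eq by (auto; lra).
  fold m. field. lra. }
assert (Hcz : (c * f z0)%C = RtoC m).
{ unfold c. assert (E := Cmod2_conj (f z0)). fold m in E.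
  replace (Cconj (f z0) / m * f z0)%C with ((f z0 * Cconj (f z0)) / m)%C by (field; auto).
  rewrite <- E. replace (m ^ 2) with (m * m) by ring. rewrite RtoC_mult. field; auto. }
set (F := fun w => (c * f w)%C).
set (e := (m - M) / (2 * R0 ^ 2)).
assert (He : 0 < e) by (apply Rdiv_lt_0_compat; nra).
assert (HeR : e * R0 ^ 2 = (m - M) / 2) by (unfold e; field; lra).
set (h := fun w => Re (F w) + e * Cmod w ^ 2).
destruct (Ccont_attains_max h R0) as [p [Hp Hmax]]; [lra | |].
{ intros z Hz.
  apply Ccont_ext_near with (f := fun w => (RtoC (Re (F w)) + RtoC e * (RtoC (Cmod w) * RtoC (Cmod w)))%C)
    (d := 1); [lra | |].
  - intros w _. unfold h. rewrite RtoC_plus, !RtoC_mult. f_equal. f_equal.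
    replace (Cmod w ^ 2) with (Cmod w * Cmod w) by ring. now rewrite RtoC_mult.
  - apply Ccont_plus.
    + apply Ccont_Re. apply Ccont_mult; [apply Ccont_const | now apply Hc].
    + apply Ccont_mult; [apply Ccont_const |].
      apply Ccont_mult; apply Ccont_Cmod, Ccont_id. }
assert (Hph : m <= h p).
{ eapply Rle_trans; [| apply (Hmax z0 Hz0)]. unfold h, F. rewrite Hcz, re_RtoC.
  assert (0 <= e * Cmod z0 ^ 2); [| lra].
  apply Rmult_le_pos; [lra | apply pow2_ge_0]. }
assert (HpR : Cmod p < R0).
{ destruct Hp as [| E]; auto. exfalso.
  unfold h in Hph. assert (L := re_le_Cmod (F p)). unfold F in L at 2.
  rewrite Cmod_mult, Hc1 in L. specialize (HM p E).
  rewrite E, HeR in Hph. generalize (Rle_abs (Re (F p))). lra. }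
(* The punctured disk of radius [r] around [p] has to avoid 0 unless [p = 0]. *)
assert (Hr : exists r, 0 < r /\ r <= R0 - Cmod p /\
   forall z, 0 < Cmod (z - p) < r -> 0 < Cmod z < R0).
{ destruct (Ceq_dec p 0) as [-> | np].
  - exists R0. rewrite Cmod_0. split; [lra | split; [lra |]].
    intros z Hz. now replace (z - 0)%C with z in Hz by ring.
  - assert (P : 0 < Cmod p) by now apply Cmod_gt_0.
    exists (Rmin (Cmod p) (R0 - Cmod p)). split; [apply Rmin_glb_lt; lra |].
    split; [apply Rmin_r |]. intros z [Hz1 Hz2]. apply Rmin_Rgt in Hz2.
    generalize (Cmod_triangle_rev p z) (Cmod_triangle_rev z p). rewrite (Cmod_minus_comm p z). lra. }
destruct Hr as [r [Hr0 [HrR Hr]]].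
set (s := r / 2). set (rho := ln s).
assert (Hs : exp rho = s) by (apply exp_ln; unfold s; lra).
assert (I := mean_value F p r rho).
assert (I1 := is_RInt_fct_extend_fst (U := R_NormedModule) (V := R_NormedModule) _ _ _ _ (I
  (fun z Hz => Cdiff_mult _ _ _ (Cdiff_const c z) (Hd z (Hr z Hz)))
  (Ccont_mult _ _ _ (Ccont_const c p) (Hc p (Rlt_le _ _ HpR)))
  ltac:(rewrite Hs; unfold s; lra))).
clear I.
assert (Pi := PI_RGT_0).
(* The bound on the circle is [Re (F p) + e |p|^2 - e |w|^2] with
   [|w|^2 = |p|^2 + s^2 + 2 s Re (conj p e^(i th))]. *)
set (a := Re p). set (b := Im p).
assert (I2 : is_RInt (fun th => Re (F p) - e * s ^ 2 - 2 * e * s * (a * cos th + b * sin th))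
  0 (2 * PI) (2 * PI * (Re (F p) - e * s ^ 2))).
{ apply is_RInt_trig. }
assert (L : 2 * PI * Re (F p) <= 2 * PI * (Re (F p) - e * s ^ 2)).
{ replace (2 * PI * Re (F p)) with (fst (2 * PI * F p)%C) by (simpl; unfold Re; ring).
  refine (is_RInt_le _ _ 0 (2 * PI) _ _ _ I1 I2 _); [lra |].
  intros th _. set (w := (p + Cexp (RtoC rho + RtoC th * Ci))%C).
  assert (Ew : w = (a + s * cos th, b + s * sin th)).
  { unfold w, Cexp. rewrite vertical_pt. simpl. rewrite Hs. reflexivity. }
  assert (Hw : Cmod w <= R0).
  { unfold w. eapply Rle_trans; [apply Cmod_triangle |]. rewrite Cmod_Cexp, vertical_pt.
    simpl. rewrite Hs. unfold s. lra. }
  specialize (Hmax w Hw). unfold h in Hmax. rewrite !Cmod2_alt in Hmax.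
  change (Re (F w) <= Re (F p) - e * s ^ 2 - 2 * e * s * (a * cos th + b * sin th)).
  fold a b in Hmax.
  assert (Re w ^ 2 + Im w ^ 2 = a ^ 2 + b ^ 2 + s ^ 2 + 2 * s * (a * cos th + b * sin th)).
  { rewrite Ew. simpl. assert (T := sin2_cos2 th). unfold Rsqr in T.
    replace (s * (s * 1)) with (s * s * (sin th * sin th + cos th * cos th)) by (rewrite T; ring).
    ring. }
  nra. }
assert (0 < e * s ^ 2) by (apply Rmult_lt_0_compat; [exact He | apply pow_lt; unfold s; lra]).
nra.
Qed.

Lemma mult_le_at_sup (a b k m : R) : a < b ->
  (forall x, a < x < b -> x * k <= m) -> b * k <= m.
Proof.
intros Hab H. apply Rnot_lt_le. intros L.
assert (K : 0 < Rabs k + 1) by (generalize (Rabs_pos k); lra).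
set (d := Rmin ((b - a) / 2) ((b * k - m) / (2 * (Rabs k + 1)))).
assert (D1 : d <= (b - a) / 2) by apply Rmin_l.
assert (D2 : d <= (b * k - m) / (2 * (Rabs k + 1))) by apply Rmin_r.
assert (D0 : 0 < d) by (apply Rmin_glb_lt; [lra | apply Rdiv_lt_0_compat; lra]).
specialize (H (b - d) ltac:(lra)).
assert (D3 : d * (Rabs k + 1) <= (b * k - m) / 2).
{ apply Rmult_le_compat_r with (r := Rabs k + 1) in D2; [| lra].
  replace ((b * k - m) / (2 * (Rabs k + 1)) * (Rabs k + 1)) with ((b * k - m) / 2) in D2
    by (field; lra). exact D2. }
assert (d * k <= d * (Rabs k + 1)) by (apply Rmult_le_compat_l; [lra | generalize (Rle_abs k); lra]).
lra.
Qed.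

(** The maximum principle for [f z / z] on the disks of radius [x < R0]. *)
Lemma schwarz (f : C -> C) (R0 M : R) : 0 < R0 ->
  (forall z, Cmod z < R0 -> Cdiff f z) ->
  (forall z, Cmod z < R0 -> Cmod (f z) <= M) -> f 0 = 0 ->
  forall z, Cmod z < R0 -> R0 * Cmod (f z) <= M * Cmod z.
Proof.
intros HR Hd HM H0 z Hz.
apply (mult_le_at_sup (Cmod z)); [exact Hz |]. intros x Hx.
assert (Hx0 : 0 < x) by (generalize (Cmod_ge_0 z); lra).
destruct (Hd 0) as [l Hl]; [now rewrite Cmod_0 |].
set (g := fun w => if Ceq_dec w 0 then l else (f w / w)%C).
assert (Hg0 : Ccont g 0).
{ apply Cderiv_slope in Hl. eapply Ccont_ext_near; [exact Rlt_0_1 | | exact Hl].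
  intros w _. unfold g. destruct (Ceq_dec w 0); auto. rewrite H0. f_equal; ring. }
assert (Hg : forall w, 0 < Cmod w < R0 -> Cdiff g w).
{ intros w Hw. apply Cdiff_ext_near with (f := fun w => (f w / w)%C) (d := Cmod w); [lra | |].
  - intros u Hu. unfold g. destruct (Ceq_dec u 0) as [-> | n]; auto.
    rewrite Cmod_minus_comm in Hu. replace (w - 0)%C with w in Hu by ring. lra.
  - apply Cdiff_div; [now apply Hd | apply Cdiff_id | now apply Cmod_gt_0]. }
assert (Hgc : forall w, Cmod w <= x -> Ccont g w).
{ intros w Hw. destruct (Ceq_dec w 0) as [-> | n]; auto.
  apply Cdiff_cont, Hg. split; [now apply Cmod_gt_0 | lra]. }
destruct (Ceq_dec z 0) as [-> | nz].
{ rewrite H0, Cmod_0. lra. }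
assert (Hz0 : 0 < Cmod z) by now apply Cmod_gt_0.
assert (B : Cmod (g z) <= M / x).
{ apply (max_modulus g x); auto; [| | lra].
  - intros w Hw. apply Hg. lra.
  - intros w Hw. unfold g. destruct (Ceq_dec w 0) as [-> | n].
    + rewrite Cmod_0 in Hw. lra.
    + rewrite Cmod_div, Hw by auto. apply Rmult_le_compat_r.
      * apply Rlt_le, Rinv_0_lt_compat. lra.
      * apply HM. lra. }
unfold g in B. destruct (Ceq_dec z 0) as [| _]; [easy |].
rewrite Cmod_div in B by auto.
apply Rmult_le_compat_r with (r := x * Cmod z) in B; [| nra].
replace (Cmod (f z) / Cmod z * (x * Cmod z)) with (x * Cmod (f z)) in B by (field; lra).
replace (M / x * (x * Cmod z)) with (M * Cmod z) in B by (field; lra). exact B.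
Qed.

(** Since [f] is 0 near 0, so is [f z / z], which is therefore holomorphic without
    any removable singularity argument; each division gains one power by
    [schwarz]. *)
Lemma vanishing_near_0_power (n : nat) : forall (f : C -> C) (r R0 M : R), 0 < r -> 0 < R0 ->
  (forall z, Cmod z < R0 -> Cdiff f z) ->
  (forall z, Cmod z < R0 -> Cmod (f z) <= M) ->
  (forall z, Cmod z < r -> f z = 0) ->
  forall z, Cmod z < R0 -> R0 ^ n * Cmod (f z) <= M * Cmod z ^ n.
Proof.
induction n as [| n IH]; intros f r R0 M Hr HR Hd HM H0 z Hz.
{ simpl. rewrite Rmult_1_l, Rmult_1_r. now apply HM. }
set (g := fun w => (f w / w)%C).
assert (Hg0 : forall w, Cmod w < r -> g w = 0).
{ intros w Hw. unfold g. rewrite H0 by exact Hw. unfold Cdiv. ring. }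
assert (Hff : f 0 = 0) by (apply H0; rewrite Cmod_0; lra).
destruct (Ceq_dec z 0) as [-> | nz].
{ rewrite Hff, Cmod_0. simpl. lra. }
assert (G : R0 ^ n * Cmod (g z) <= M / R0 * Cmod z ^ n).
{ apply (IH g r R0); auto.
  - intros w Hw. destruct (Rlt_dec (Cmod w) r) as [L | L].
    + apply Cdiff_ext_near with (f := fun _ => RtoC 0) (d := r - Cmod w); [lra | | apply Cdiff_const].
      intros u Hu. symmetry. apply Hg0. generalize (Cmod_triangle_rev u w). lra.
    + apply Cdiff_div; [now apply Hd | apply Cdiff_id |].
      apply Cmod_gt_0. lra.
  - intros w Hw. destruct (Ceq_dec w 0) as [-> | nw].
    { rewrite Hg0 by (rewrite Cmod_0; lra). rewrite Cmod_0.
      apply Rmult_le_pos; [| apply Rlt_le, Rinv_0_lt_compat; lra].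
      eapply Rle_trans; [apply Cmod_ge_0 | apply (HM 0)]. rewrite Cmod_0; lra. }
    assert (S := schwarz f R0 M HR Hd HM Hff w Hw).
    assert (P : 0 < Cmod w) by now apply Cmod_gt_0.
    unfold g. rewrite Cmod_div by auto.
    apply Rmult_le_reg_r with (R0 * Cmod w); [nra |].
    replace (Cmod (f w) / Cmod w * (R0 * Cmod w)) with (R0 * Cmod (f w)) by (field; lra).
    replace (M / R0 * (R0 * Cmod w)) with (M * Cmod w) by (field; lra). exact S. }
assert (P : 0 < Cmod z) by now apply Cmod_gt_0.
unfold g in G. rewrite Cmod_div in G by auto.
apply Rmult_le_compat_r with (r := R0 * Cmod z) in G; [| nra].
simpl.
replace (R0 ^ n * (Cmod (f z) / Cmod z) * (R0 * Cmod z)) with (R0 * R0 ^ n * Cmod (f z)) in G by (field; lra).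
replace (M / R0 * Cmod z ^ n * (R0 * Cmod z)) with (M * (Cmod z * Cmod z ^ n)) in G by (field; lra).
exact G.
Qed.

Lemma identity_theorem (f : C -> C) (r : R) : 0 < r ->
  (forall z, Cmod z < 1 -> Cdiff f z) -> (forall z, Cmod z < r -> f z = 0) ->
  forall z, Cmod z < 1 -> f z = 0.
Proof.
intros Hr Hd H0 z Hz.
set (R0 := (1 + Cmod z) / 2).
assert (Pz := Cmod_ge_0 z).
destruct (Ccont_bounded f R0) as [M [HM0 HM]].
{ intros w Hw. apply Cdiff_cont, Hd. unfold R0 in Hw. lra. }
assert (K := fun n => vanishing_near_0_power n f r R0 M Hr ltac:(unfold R0; lra)
  (fun w Hw => Hd w ltac:(unfold R0 in Hw; lra)) (fun w Hw => HM w (Rlt_le _ _ Hw)) H0 z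
  ltac:(unfold R0; lra)).
apply Cmod_eq_0, Rle_antisym; [| apply Cmod_ge_0]. apply Rnot_lt_le. intros P.
set (q := Cmod z / R0).
assert (HR : 0 < R0) by (unfold R0; lra).
assert (Hq : Rabs q < 1).
{ unfold q. rewrite Rabs_pos_eq.
  - apply Rmult_lt_reg_r with R0; [exact HR |]. unfold Rdiv.
    rewrite Rmult_assoc, Rinv_l by lra. unfold R0. lra.
  - apply Rmult_le_pos; [lra | apply Rlt_le, Rinv_0_lt_compat; lra]. }
destruct (pow_lt_1_zero q Hq (Cmod (f z) / M)) as [N HN].
{ apply Rdiv_lt_0_compat; lra. }
specialize (HN N (Nat.le_refl N)). specialize (K N).
assert (HRN : 0 < R0 ^ N) by now apply pow_lt.
apply Rle_lt_trans with (1 := Rle_abs _) in HN.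
unfold q in HN. unfold Rdiv in HN at 1. rewrite Rpow_mult_distr, pow_inv in HN.
apply Rmult_lt_compat_r with (r := M * R0 ^ N) in HN; [| nra].
replace (Cmod z ^ N * / R0 ^ N * (M * R0 ^ N)) with (M * Cmod z ^ N) in HN by (field; lra).
replace (Cmod (f z) / M * (M * R0 ^ N)) with (R0 ^ N * Cmod (f z)) in HN by (field; lra).
lra.
Qed.

(** * Logarithms on a disk *)

Lemma Cexp_surj (w : C) : w <> 0 -> exists c, Cexp c = w.
Proof.
intros Hw.
assert (K : forall c0 w', 0 < Re w' -> (Cexp c0 * w' = w)%C -> exists c, Cexp c = w).
{ intros c0 w' Hw' <-. exists (c0 + principal_log w')%C. now rewrite Cexp_plus, Cexp_principal_log. }
destruct w as [x y]. destruct (Rtotal_order x 0) as [Hx | [-> | Hx]].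
- apply (K (0, PI) (- x, - y)); simpl; [lra |].
  unfold Cexp; simpl. rewrite exp_0, cos_PI, sin_PI. apply injective_projections; simpl; ring.
- destruct (Rtotal_order y 0) as [Hy | [-> | Hy]]; [| easy |].
  + apply (K (0, - (PI / 2)) (- y, 0)); simpl; [lra |].
    unfold Cexp; simpl. rewrite exp_0, cos_neg, sin_neg, cos_PI2, sin_PI2.
    apply injective_projections; simpl; ring.
  + apply (K (0, PI / 2) (y, 0)); simpl; [lra |].
    unfold Cexp; simpl. rewrite exp_0, cos_PI2, sin_PI2.
    apply injective_projections; simpl; ring.
- apply (K 0 (x, y)); simpl; [lra |]. rewrite Cexp_0. ring.
Qed.

Lemma Re_pos_of_near_1 (q : C) : Cmod (q - 1) < 1 -> 0 < Re q.
Proof.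
intros H. assert (L := re_le_Cmod (q - 1)).
replace (Re (q - 1)%C) with (Re q - 1) in L by reflexivity.
generalize (Rabs_def2 _ _ (Rle_lt_trans _ _ _ L H)). lra.
Qed.

(** Uniform continuity of [f], in the form needed to take principal logarithms of
    quotients of nearby values. *)
Lemma uniform_ratio (f : C -> C) (R0 : R) :
  (forall z, Cmod z <= R0 -> Ccont f z) -> (forall z, Cmod z <= R0 -> f z <> 0) ->
  exists d, 0 < d /\ forall z w, Cmod z <= R0 -> Cmod (w - z) < d -> 0 < Re (f w / f z).
Proof.
intros Hf H0.
assert (E : forall u, exists d, Cmod u <= R0 -> 0 < d /\
   forall w, Cmod (w - u) < 2 * d -> Cmod (f w - f u) < Cmod (f u) / 4).
{ intros u. destruct (Rle_dec (Cmod u) R0) as [H | H]; [| now exists 0].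
  destruct (proj1 (Ccont_eps _ _) (Hf u H) (Cmod (f u) / 4)) as [d [Hd H1]].
  { assert (0 < Cmod (f u)) by now apply Cmod_gt_0, H0. lra. }
  exists (d / 2). intros _. split; [lra |]. intros w Hw. apply H1. lra. }
set (delta := fun u => proj1_sig (constructive_indefinite_description _ (E u))).
assert (Hdelta := fun u => proj2_sig (constructive_indefinite_description _ (E u))).
change (forall u, Cmod u <= R0 -> 0 < delta u /\
   forall w, Cmod (w - u) < 2 * delta u -> Cmod (f w - f u) < Cmod (f u) / 4) in Hdelta.
destruct (disc_gauge R0 delta) as [d [Hd H]].
{ intros z Hz. now apply (Hdelta z). }
exists d; split; [exact Hd |]. intros z w Hz Hw.
destruct (H z Hz) as (u & Hu & H1 & H2). destruct (Hdelta u Hu) as [H3 H4].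
assert (A := H4 z ltac:(lra)).
assert (B : Cmod (f w - f u) < Cmod (f u) / 4).
{ apply H4. replace (w - u)%C with ((w - z) + (z - u))%C by ring.
  eapply Rle_lt_trans; [apply Cmod_triangle | lra]. }
apply Re_pos_of_near_1.
replace (f w / f z - 1)%C with ((f w - f z) / f z)%C by (field; now apply H0).
rewrite Cmod_div by now apply H0.
assert (P : 0 < Cmod (f z)) by now apply Cmod_gt_0, H0.
apply Rmult_lt_reg_r with (Cmod (f z)); [exact P |].
unfold Rdiv. rewrite Rmult_assoc, Rinv_l, Rmult_1_r, Rmult_1_l by lra.
replace (f w - f z)%C with ((f w - f u) + - (f z - f u))%C by ring.
eapply Rle_lt_trans; [apply Cmod_triangle |]. rewrite Cmod_opp.
generalize (Cmod_triangle_rev (f u) (f z)). rewrite (Cmod_minus_comm (f u)). lra.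
Qed.

(** The logarithm at [z] is the sum of a logarithm of [f 0] and of the principal
    logarithms of [f ((k+1) z / n) / f (k z / n)] for [k < n].  For [n] large
    these quotients have positive real part, so each term is continuous in [z]. *)
Lemma continuous_log (f : C -> C) (R0 : R) : 0 < R0 ->
  (forall z, Cmod z <= R0 -> Ccont f z) -> (forall z, Cmod z <= R0 -> f z <> 0) ->
  exists L, forall z, Cmod z <= R0 -> Ccont L z /\ Cexp (L z) = f z.
Proof.
intros HR Hf H0.
destruct (uniform_ratio f R0 Hf H0) as [d [Hd H]].
destruct (INR_unbounded (R0 / d)) as [n Hn].
assert (P : 0 < R0 / d) by now apply Rdiv_lt_0_compat.
assert (Hn0 : 0 < INR n) by lra.
set (pt := fun (k : nat) z => (RtoC (INR k / INR n) * z)%C).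
assert (Hpt : forall k z, (k <= n)%nat -> Cmod z <= R0 -> Cmod (pt k z) <= R0).
{ intros k z Hk Hz. unfold pt. rewrite Cmod_mult, Cmod_R.
  apply le_INR in Hk. assert (0 <= INR k) by apply pos_INR.
  assert (INR k / INR n <= 1).
  { apply Rmult_le_reg_r with (INR n); [exact Hn0 |].
    unfold Rdiv. rewrite Rmult_assoc, Rinv_l; lra. }
  rewrite Rabs_pos_eq by (apply Rmult_le_pos; [lra | apply Rlt_le, Rinv_0_lt_compat; lra]).
  generalize (Cmod_ge_0 z). nra. }
assert (Hcpt : forall k z, (k <= n)%nat -> Cmod z <= R0 -> Ccont (fun z => f (pt k z)) z).
{ intros k z Hk Hz. apply (Ccont_comp (pt k) f).
  - apply Ccont_mult; [apply Ccont_const | apply Ccont_id].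
  - apply Hf. now apply Hpt. }
assert (K : forall k, (k <= n)%nat -> exists L, forall z, Cmod z <= R0 ->
  Ccont L z /\ Cexp (L z) = f (pt k z)).
{ induction k as [| k IH]; intros Hk.
  - destruct (Cexp_surj (f 0)) as [c Hc]; [apply H0; rewrite Cmod_0; lra |].
    exists (fun _ => c). intros z _. split; [apply Ccont_const |].
    rewrite Hc. f_equal. unfold pt. simpl. unfold Rdiv. rewrite Rmult_0_l. ring.
  - destruct IH as [L HL]; [lia |].
    exists (fun z => L z + principal_log (f (pt (S k) z) / f (pt k z)))%C. intros z Hz.
    destruct (HL z Hz) as [HL1 HL2].
    assert (Q : 0 < Re (f (pt (S k) z) / f (pt k z))).
    { apply H; [apply Hpt; [lia | exact Hz] |]. unfold pt.
      replace (RtoC (INR (S k) / INR n) * z - RtoC (INR k / INR n) * z)%C with (RtoC (/ INR n) * z)%C.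
      - rewrite Cmod_mult, Cmod_R, Rabs_pos_eq by (apply Rlt_le, Rinv_0_lt_compat; lra).
        apply Rle_lt_trans with (/ INR n * R0).
        + apply Rmult_le_compat_l; [apply Rlt_le, Rinv_0_lt_compat; lra | exact Hz].
        + apply Rmult_lt_reg_l with (INR n); [exact Hn0 |].
          rewrite <- Rmult_assoc, Rinv_r, Rmult_1_l by lra.
          apply Rmult_lt_compat_r with (r := d) in Hn; [| exact Hd].
          unfold Rdiv in Hn. rewrite Rmult_assoc, Rinv_l, Rmult_1_r in Hn; lra.
      - rewrite S_INR. replace ((INR k + 1) / INR n) with (INR k / INR n + / INR n) by (field; lra).
        rewrite RtoC_plus. ring. }
    split.
    + apply Ccont_plus; [exact HL1 |].
      apply (Ccont_comp (fun z => f (pt (S k) z) / f (pt k z))%C principal_log).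
      * apply Ccont_div; [apply Hcpt; auto | apply Hcpt; auto; lia |].
        apply H0, Hpt; auto; lia.
      * now apply Ccont_principal_log.
    + rewrite Cexp_plus, Cexp_principal_log, HL2 by exact Q.
      assert (f (pt k z) <> 0) by (apply H0, Hpt; auto; lia). field; auto. }
destruct (K n (Nat.le_refl n)) as [L HL]. exists L. intros z Hz.
destruct (HL z Hz) as [HL1 HL2]. split; [exact HL1 |]. rewrite HL2. f_equal.
unfold pt. replace (INR n / INR n) with 1 by (field; lra). ring.
Qed.

Lemma Ccont_nonzero_near (f : C -> C) z : Ccont f z -> f z <> 0 ->
  exists d, 0 < d /\ forall w, Cmod (w - z) < d -> f w <> 0.
Proof.
intros Hf H0.
destruct (proj1 (Ccont_eps _ _) Hf (Cmod (f z))) as [d [Hd H]].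
{ now apply Cmod_gt_0. }
exists d; split; [exact Hd |]. intros w Hw E. specialize (H w Hw).
rewrite E, Cmod_minus_comm in H. replace (f z - 0)%C with (f z) in H by ring. lra.
Qed.

(** The inverse function rule for [Cexp]: the slope of [L] is the slope of [f]
    divided by the slope of [Cexp] along [L], which is close to
    [Cexp (L z) <> 0]. *)
Lemma Cdiff_log (f L : C -> C) z d : 0 < d -> Ccont L z ->
  (forall w, Cmod (w - z) < d -> Cexp (L w) = f w) -> Cdiff f z -> Cdiff L z.
Proof.
intros Hd HL HE [l Hl].
assert (E := Cderiv_exp (L z)).
apply Cderiv_slope in Hl, E.
set (phi := fun w => if Ceq_dec w z then l else ((f w - f z) / (w - z))%C) in Hl.
set (e := fun v => if Ceq_dec v (L z) then Cexp (L z) else ((Cexp v - Cexp (L z)) / (v - L z))%C) in E.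
change (Ccont phi z) in Hl. change (Ccont e (L z)) in E.
assert (He0 : e (L z) <> 0).
{ unfold e. destruct (Ceq_dec (L z) (L z)); [apply Cexp_neq_0 | easy]. }
assert (HeL := Ccont_comp L e z HL E).
destruct (Ccont_nonzero_near _ _ HeL He0) as [d' [Hd' Hn]].
exists (phi z / e (L z))%C. apply Cderiv_slope.
apply Ccont_ext_near with (f := fun w => (phi w / e (L w))%C) (d := Rmin d d');
  [now apply Rmin_glb_lt | | now apply Ccont_div].
intros w Hw. apply Rmin_Rgt in Hw. destruct Hw as [Hw1 Hw2].
destruct (Ceq_dec w z) as [-> | n]; auto.
specialize (Hn w Hw2).
assert (A : (e (L w) * (L w - L z) = Cexp (L w) - Cexp (L z))%C).
{ unfold e. destruct (Ceq_dec (L w) (L z)) as [-> | n'].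
  - ring.
  - field. now apply Cminus_eq_contra. }
assert (HEz : Cexp (L z) = f z).
{ apply HE. replace (z - z)%C with (RtoC 0) by ring. now rewrite Cmod_0. }
rewrite (HE w Hw1), HEz in A.
assert (B : (phi w * (w - z) = f w - f z)%C).
{ unfold phi. destruct (Ceq_dec w z); [easy |]. field. now apply Cminus_eq_contra. }
rewrite <- B in A.
assert (w - z <> 0)%C by now apply Cminus_eq_contra.
replace (L w - L z)%C with (phi w * (w - z) / e (L w))%C; [field; auto |].
rewrite <- A. field; auto.
Qed.

Lemma holomorphic_log (f : C -> C) (R0 : R) : 0 < R0 ->
  (forall z, Cmod z <= R0 -> Cdiff f z) -> (forall z, Cmod z <= R0 -> f z <> 0) ->
  exists L, (forall z, Cmod z < R0 -> Cdiff L z) /\ forall z, Cmod z <= R0 -> Cexp (L z) = f z.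
Proof.
intros HR Hf H0.
destruct (continuous_log f R0 HR (fun z Hz => Cdiff_cont f z (Hf z Hz)) H0) as [L HL].
exists L. split; [| intros z Hz; now apply HL]. intros z Hz.
apply (Cdiff_log f L z (R0 - Cmod z)); [lra | apply HL; lra | | apply Hf; lra].
intros w Hw. apply HL. generalize (Cmod_triangle_rev w z). lra.
Qed.

(** * Harnack inequality for functions without zeros *)

(** Let [L] be a logarithm of [f / (2 M)]; the factor 2 makes [Re L] strictly
    negative.  The Cayley transform [(L - L 0) / (L + conj (L 0))] maps the disk
    into the unit disk and 0 to 0, so by [schwarz] it is at most 1/2 in modulus
    for [|t| <= R1 / 2].  This says that [Re (L t)] and [Re (L 0)] differ at most
    by a factor 3, which becomes an exponent. *)
Lemma harnack_nonvanishing (f : C -> C) (R0 M : R) : 0 < M ->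
  (forall z, Cmod z < R0 -> Cdiff f z) -> (forall z, Cmod z < R0 -> f z <> 0) ->
  (forall z, Cmod z < R0 -> Cmod (f z) <= M) ->
  forall t, Cmod t < R0 / 2 ->
  (Cmod (f t) / (2 * M)) ^ 3 <= Cmod (f 0) / (2 * M) /\
  (Cmod (f 0) / (2 * M)) ^ 3 <= Cmod (f t) / (2 * M).
Proof.
intros HM Hd H0 Hb t Ht.
assert (Pt := Cmod_ge_0 t).
set (R1 := (2 * Cmod t + R0) / 2).
assert (HR1 : 2 * Cmod t < R1 < R0) by (unfold R1; lra).
assert (HMc : RtoC (2 * M) <> 0) by (intros E; apply (f_equal fst) in E; simpl in E; lra).
destruct (holomorphic_log (fun z => f z / RtoC (2 * M))%C R1) as [L [HL HE]]; [lra | | |].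
{ intros z Hz. apply Cdiff_div; [apply Hd; lra | apply Cdiff_const | exact HMc]. }
{ intros z Hz E. apply (H0 z); [lra |].
  replace (f z) with (f z / RtoC (2 * M) * RtoC (2 * M))%C by (field; auto).
  rewrite E. ring. }
assert (HRe : forall z, Cmod z <= R1 -> exp (Re (L z)) = Cmod (f z) / (2 * M)).
{ intros z Hz. rewrite <- Cmod_Cexp, HE by exact Hz.
  rewrite Cmod_div, Cmod_R, Rabs_pos_eq by (auto; lra). reflexivity. }
assert (Hneg : forall z, Cmod z <= R1 -> Re (L z) < 0).
{ intros z Hz. apply exp_lt_inv. rewrite HRe, exp_0 by exact Hz.
  specialize (Hb z ltac:(lra)). apply Rmult_lt_reg_r with (2 * M); [lra |].
  unfold Rdiv. rewrite Rmult_assoc, Rinv_l; lra. }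
assert (H00 : Cmod 0 <= R1) by (rewrite Cmod_0; lra).
set (x0 := Re (L 0)).
assert (Hx0 : x0 < 0) by now apply Hneg.
assert (Hden : forall z, Cmod z <= R1 -> (L z + Cconj (L 0))%C <> 0).
{ intros z Hz E. apply (f_equal Re) in E. rewrite re_plus, re_conj in E.
  fold x0 in E. specialize (Hneg z Hz). simpl in E. lra. }
assert (S : R1 * Cmod ((L t - L 0) / (L t + Cconj (L 0)))%C <= 1 * Cmod t).
{ apply (schwarz (fun z => (L z - L 0) / (L z + Cconj (L 0)))%C R1 1); try lra.
  - intros z Hz. apply Cdiff_div; [| | apply Hden; lra].
    + apply Cdiff_minus; [now apply HL | apply Cdiff_const].
    + apply Cdiff_plus; [now apply HL | apply Cdiff_const].
  - intros z Hz. rewrite Cmod_div by (apply Hden; lra).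
    assert (P : 0 < Cmod (L z + Cconj (L 0))) by (apply Cmod_gt_0, Hden; lra).
    apply Rmult_le_reg_r with (1 := P). unfold Rdiv.
    rewrite Rmult_assoc, Rinv_l, Rmult_1_r, Rmult_1_l by lra.
    apply Rsqr_incr_0_var; [| lra]. rewrite !Rsqr_pow2, !Cmod2_alt.
    specialize (Hneg z ltac:(lra)).
    assert (P2 : 0 <= Re (L z) * x0) by nra. unfold x0 in P2.
    destruct (L z) as [x y]; destruct (L 0) as [x1 y1]. simpl in P2 |- *. nra.
  - unfold Cminus, Cdiv. rewrite Cplus_opp_r. ring. }
assert (Hxt : Re (L t) < 0) by (apply Hneg; lra).
assert (Q : 2 * Cmod (L t - L 0) <= Cmod (L t + Cconj (L 0))).
{ assert (P : 0 < Cmod (L t + Cconj (L 0))) by (apply Cmod_gt_0, Hden; lra).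
  rewrite Cmod_div in S by (apply Hden; lra).
  apply Rmult_le_compat_r with (r := Cmod (L t + Cconj (L 0))) in S; [| lra].
  unfold Rdiv in S. rewrite Rmult_assoc, (Rmult_assoc (Cmod (L t - L 0))), Rinv_l, Rmult_1_r in S by lra.
  assert (0 <= Cmod (L t - L 0)) by apply Cmod_ge_0.
  apply Rmult_le_reg_l with R1; [lra |]. nra. }
apply Rsqr_incr_1 in Q; [| generalize (Cmod_ge_0 (L t - L 0)); lra | apply Cmod_ge_0].
rewrite Rsqr_mult, !Rsqr_pow2, !Cmod2_alt in Q.
rewrite <- !HRe by lra.
fold x0. set (x := Re (L t)) in *.
assert (Q' : 4 * (x - x0) ^ 2 <= (x + x0) ^ 2).
{ assert (A : forall u v : C,
    2 ^ 2 * (Re (u - v)%C ^ 2 + Im (u - v)%C ^ 2)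
      <= Re (u + Cconj v)%C ^ 2 + Im (u + Cconj v)%C ^ 2 ->
    4 * (Re u - Re v) ^ 2 <= (Re u + Re v) ^ 2).
  { intros [a b] [a0 b0]. simpl. intros. assert (0 <= (b + - b0) ^ 2) by apply pow2_ge_0. simpl in *. lra. }
  now apply A. }
assert (E3 : forall u, exp u ^ 3 = exp (3 * u)).
{ intros u. replace (3 * u) with (u + (u + u)) by ring. rewrite !exp_plus. ring. }
assert (Hmono : forall a b, a <= b -> exp a <= exp b).
{ intros a b [H | ->]; [left; now apply exp_increasing | lra]. }
rewrite !E3. split; apply Hmono; nra.
Qed.

(** * Perturbations of the identity cover a disk *)

Lemma Ccont_vertical (u : C -> R) (rho th : R) : Ccont (fun w => RtoC (u w)) (rho, th) ->
  continuity_pt (fun s => u (rho, s)) th.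
Proof.
intros H. apply continuity_pt_filterlim. intros P [e He].
destruct (proj1 (Ccont_eps _ _) H e (cond_pos e)) as [d [Hd H1]].
exists (mkposreal d Hd). intros s Hs. apply He.
specialize (H1 (rho, s)). rewrite <- RtoC_minus, Cmod_R in H1. apply H1.
change ((rho, s) - (rho, th))%C with (rho - rho, s - th).
eapply Rle_lt_trans; [apply Cmod_le_abs |]. rewrite Rminus_diag, Rabs_R0, Rplus_0_l. exact Hs.
Qed.

(** If [p] were not a value, [v - p] would have a continuous logarithm on the
    disk, so its argument would return to its initial value along the circle.
    But on the circle [(v w - p) / w] lies in the right half plane, so the
    argument of [v w - p] increases by [2 PI], like that of [w]. *)
Lemma disc_covering (v : C -> C) (r : R) (p : C) : 0 < r ->
  (forall w, Cmod w <= r -> Ccont v w) ->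
  (forall w, Cmod w = r -> Cmod (v w - w) <= r / 2) -> Cmod p < r / 2 ->
  exists w, Cmod w <= r /\ v w = p.
Proof.
intros Hr Hv Hb Hp. apply NNPP. intros Hno.
set (f := fun w => (v w - p)%C).
assert (Hf : forall w, Cmod w <= r -> Ccont f w).
{ intros w Hw. apply Ccont_minus; [now apply Hv | apply Ccont_const]. }
destruct (continuous_log f r Hr Hf) as [L HL].
{ intros w Hw E. apply Hno. exists w. split; [exact Hw | now apply Ceq_minus]. }
set (rho := ln r).
set (g := fun th : R => Cexp (rho, th)).
assert (Hg : forall th, Cmod (g th) = r).
{ intros th. unfold g. rewrite Cmod_Cexp. simpl. now apply exp_ln. }
assert (Hq : forall th, 0 < Re (f (g th) / g th)).
{ intros th. apply Re_pos_of_near_1. unfold f.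
  replace ((v (g th) - p) / g th - 1)%C with ((v (g th) - g th - p) / g th)%C
    by (field; apply Cexp_neq_0).
  rewrite Cmod_div, Hg by apply Cexp_neq_0.
  apply Rmult_lt_reg_r with r; [exact Hr |].
  unfold Rdiv. rewrite Rmult_assoc, Rinv_l, Rmult_1_r, Rmult_1_l by lra.
  eapply Rle_lt_trans; [apply Cmod_triangle |]. rewrite Cmod_opp.
  specialize (Hb (g th) (Hg th)). lra. }
(* In the coordinate [w = rho + i th] on the circle, [K] is the difference of two
   logarithms of [f], hence a multiple of [2 PI i], and yet its imaginary part
   drops by [2 PI] over one turn. *)
set (K := fun w => (L (Cexp w) - principal_log (f (Cexp w) / Cexp w) - w)%C).
assert (HK1 : forall th, Cexp (K (rho, th)) = 1).
{ intros th. unfold K. fold (g th).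
  assert (A : Cexp (L (g th)) = f (g th)) by (apply HL; rewrite Hg; lra).
  assert (B := Cexp_principal_log _ (Hq th)).
  set (P := principal_log (f (g th) / g th)) in *.
  assert (E : (Cexp (L (g th) - P - (rho, th)) * (Cexp P * Cexp (rho, th)))%C = Cexp (L (g th))).
  { rewrite <- !Cexp_plus. f_equal. ring. }
  rewrite A, B in E. fold (g th) in E.
  assert (G0 : g th <> 0) by apply Cexp_neq_0.
  replace (f (g th) / g th * g th)%C with (f (g th)) in E by (field; auto).
  assert (F0 : f (g th) <> 0) by (rewrite <- A; apply Cexp_neq_0).
  replace (Cexp (L (g th) - P - (rho, th)))%C
    with (Cexp (L (g th) - P - (rho, th)) * f (g th) / f (g th))%C by (field; auto).
  rewrite E. field; auto. }
set (N := fun th : R => Im (K (rho, th))).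
assert (HN : forall th, continuity_pt N th).
{ intros th. apply (Ccont_vertical (fun w => Im (K w))), Ccont_Im.
  apply Ccont_minus; [| apply Ccont_id]. apply Ccont_minus.
  - apply (Ccont_comp Cexp L); [apply Cdiff_cont, Cdiff_exp |].
    apply HL. fold (g th). rewrite Hg. lra.
  - apply (Ccont_comp (fun w => f (Cexp w) / Cexp w)%C principal_log); [| apply Ccont_principal_log, Hq].
    apply Ccont_div; [| apply Cdiff_cont, Cdiff_exp | apply Cexp_neq_0].
    apply (Ccont_comp Cexp f); [apply Cdiff_cont, Cdiff_exp |].
    apply Hf. fold (g th). rewrite Hg. lra. }
assert (Hcos : forall th, 0 < cos (N th)).
{ intros th. assert (E := f_equal fst (HK1 th)).
  change (exp (Re (K (rho, th))) * cos (N th) = 1) in E.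
  assert (P := exp_pos (Re (K (rho, th)))).
  apply Rnot_le_lt. intros Q. nra. }
assert (Hper : N (2 * PI) = N 0 - 2 * PI).
{ unfold N, K.
  replace (Cexp (rho, 2 * PI)) with (Cexp (rho, 0))
    by (unfold Cexp; simpl; now rewrite cos_2PI, sin_2PI, cos_0, sin_0).
  unfold Im, Cminus, Cplus, Copp; simpl. ring. }
assert (Pi := PI_RGT_0).
destruct (IVT_interv (fun th => N 0 - PI - N th) 0 (2 * PI)) as [th [_ Hth]].
- intros th _. apply continuity_pt_minus; [| apply HN].
  apply continuity_pt_const. now intros ? ?.
- lra.
- lra.
- rewrite Hper. lra.
- assert (C0 := Hcos 0). assert (C1 := Hcos th).
  replace (N th) with (N 0 - PI) in C1 by lra.
  rewrite cos_minus, cos_PI, sin_PI in C1. lra.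
Qed.

(** * Baire category in a rectangle *)

Definition fat_rect (r : rect) : Prop := xl r < xr r /\ yl r < yr r.

(** The conclusion says that [P N] is dense in [r].  Otherwise each rectangle
    contains a smaller one that avoids [P n], and a point common to the nested
    rectangles so obtained satisfies no [P N]. *)
Lemma baire_rect (P : nat -> C -> Prop) (r0 : rect) : fat_rect r0 ->
  (forall z, in_rect r0 z -> exists N, P N z) ->
  exists N r, fat_rect r /\ subrect r r0 /\
    forall r', fat_rect r' -> subrect r' r -> exists z, in_rect r' z /\ P N z.
Proof.
intros Hfat HP. apply NNPP. intros Hno.
destruct (nested_rectangles (fun n r => fat_rect r /\ subrect r r0 /\
  forall k z, (k < n)%nat -> in_rect r z -> ~ P k z) r0) as [u [z Hu]].
- split; [exact Hfat |]. split; [unfold subrect; lra |]. intros k z Hk. lia.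
- intros n r [H _]. unfold fat_rect, nonempty_rect in *. lra.
- intros n r (H1 & H2 & H3). apply NNPP. intros Hn. apply Hno.
  exists n, r. split; [exact H1 |]. split; [exact H2 |]. intros r' Hr' Hs.
  apply NNPP. intros Hz. apply Hn. exists r'. split; [| exact Hs].
  split; [exact Hr' |]. split; [unfold subrect in *; lra |].
  intros k z Hk Hzr HPk.
  destruct (Nat.eq_dec k n) as [-> | nk].
  + apply Hz. now exists z.
  + apply (H3 k z); [lia | | exact HPk]. unfold in_rect, subrect in *. lra.
- destruct (HP z) as [N HN].
  + destruct (Hu 0%nat) as (_ & Hz & Hs). unfold in_rect, subrect in *. lra.
  + destruct (Hu (S N)) as ((_ & _ & H3) & Hz & _). apply (H3 N z); auto.
Qed.

(** * Holomorphic motions of the closed disk *)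

(** Harnack's upper bound for [g - h]: a difference without zeros that is small
    at 0 stays small. *)
Lemma nowhere_equal_close (g h : C -> C) (R0 K : R) : 0 < K ->
  (forall t, Cmod t < R0 -> Cdiff g t) -> (forall t, Cmod t < R0 -> Cdiff h t) ->
  (forall t, Cmod t < R0 -> Cmod (g t) <= K) -> (forall t, Cmod t < R0 -> Cmod (h t) <= K) ->
  (forall t, Cmod t < R0 -> g t <> h t) ->
  forall t, Cmod t < R0 / 2 -> Cmod (g t - h t) ^ 3 <= (4 * K) ^ 2 * Cmod (g 0 - h 0).
Proof.
intros HK Hg Hh Bg Bh Hn t Ht.
destruct (harnack_nonvanishing (fun w => g w - h w)%C R0 (2 * K)) with (t := t) as [A _]; auto; try lra.
- intros z Hz. apply Cdiff_minus; auto.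
- intros z Hz. apply Cminus_eq_contra. auto.
- intros z Hz. eapply Rle_trans; [apply Cmod_triangle |]. rewrite Cmod_opp.
  specialize (Bg z Hz). specialize (Bh z Hz). lra.
- replace (2 * (2 * K)) with (4 * K) in A by ring.
  assert (P : 0 < (4 * K) ^ 3) by (apply pow_lt; lra).
  apply Rmult_le_compat_r with (r := (4 * K) ^ 3) in A; [| lra].
  unfold Rdiv in A. rewrite Rpow_mult_distr, pow_inv in A.
  replace (Cmod (g t - h t) ^ 3 * / (4 * K) ^ 3 * (4 * K) ^ 3)
    with (Cmod (g t - h t) ^ 3) in A by (field; lra).
  replace (Cmod (g 0 - h 0) * / (4 * K) * (4 * K) ^ 3)
    with ((4 * K) ^ 2 * Cmod (g 0 - h 0)) in A by (field; lra).
  exact A.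
Qed.

Lemma lt_of_cube_lt (a b : R) : 0 <= b -> a ^ 3 < b ^ 3 -> a < b.
Proof.
intros Hb H. apply Rnot_le_lt. intros L.
assert (b ^ 3 <= a ^ 3) by (apply pow_incr; lra). lra.
Qed.

Lemma motion_Cdiff V s t : holomorphic_motion closed_unit_disk V ->
  Cmod s <= 1 -> Cmod t < 1 -> Cdiff (fun t => V t s) t.
Proof.
intros HV Hs Ht. apply Cdiff_ex_derive. now apply (motion_holomorphic _ _ HV s Hs t).
Qed.

Lemma motion_bounded_at V s (R0 : R) : holomorphic_motion closed_unit_disk V ->
  Cmod s <= 1 -> R0 < 1 -> exists M, 0 < M /\ forall t, Cmod t <= R0 -> Cmod (V t s) <= M.
Proof.
intros HV Hs HR. apply (Ccont_bounded (fun t => V t s)). intros t Ht.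
apply Cdiff_cont, motion_Cdiff; auto. lra.
Qed.

(** Baire's theorem makes the points [z] with [|V t z| <= N] for [|t| < 1/2] dense
    in a rectangle.  Any [w] in it is a limit of such points, and by
    [nowhere_equal_close] the function of [w] is within 1 of that of a
    sufficiently near one, at the cost of halving the range of [t]. *)
Lemma motion_bounded_on_some_disc V : holomorphic_motion closed_unit_disk V ->
  exists (a : C) (r K : R), 0 < r /\ 0 < K /\
    (forall w, Cmod (w - a) <= r -> Cmod w <= 3 / 4) /\
    (forall w t, Cmod (w - a) <= r -> Cmod t < / 4 -> Cmod (V t w) <= K).
Proof.
intros HV.
set (r0 := Rect (- / 2) (/ 2) (- / 2) (/ 2)).
assert (Hr0 : forall z, in_rect r0 z -> Cmod z <= 3 / 4).
{ intros [x y] [Hx Hy]. simpl in Hx, Hy. apply Rsqr_incr_0_var; [| lra].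
  rewrite Rsqr_pow2, Cmod2_alt. unfold Rsqr. simpl. nra. }
destruct (baire_rect (fun N z => forall t, Cmod t < / 2 -> Cmod (V t z) <= INR N) r0)
  as (N & r & [Hx Hy] & Hs & HN).
{ split; simpl; lra. }
{ intros z Hz. destruct (motion_bounded_at V z (/ 2) HV) as [M [_ HM]]; [| lra |].
  - apply Rle_trans with (1 := Hr0 z Hz). lra.
  - destruct (INR_unbounded M) as [N HN]. exists N. intros t Ht.
    apply Rle_trans with M; [apply HM |]; lra. }
set (a := ((xl r + xr r) / 2, (yl r + yr r) / 2) : C).
set (d := Rmin (xr r - xl r) (yr r - yl r) / 4).
assert (Hd : 0 < d) by (unfold d; assert (0 < Rmin (xr r - xl r) (yr r - yl r)) by (apply Rmin_glb_lt; lra); lra).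
assert (Hdx : d <= (xr r - xl r) / 4) by (unfold d; generalize (Rmin_l (xr r - xl r) (yr r - yl r)); lra).
assert (Hdy : d <= (yr r - yl r) / 4) by (unfold d; generalize (Rmin_r (xr r - xl r) (yr r - yl r)); lra).
assert (Hin : forall w, Cmod (w - a) <= d -> xl r + d <= fst w <= xr r - d /\ yl r + d <= snd w <= yr r - d).
{ intros w Hw. assert (A := re_le_Cmod (w - a)). assert (B := im_le_Cmod (w - a)).
  apply Rle_trans with (2 := Hw) in A, B. apply Rabs_le_between in A, B.
  destruct w as [x y]. simpl in *. lra. }
assert (Hw34 : forall w, Cmod (w - a) <= d -> Cmod w <= 3 / 4).
{ intros w Hw. apply Hr0. specialize (Hin w Hw). unfold in_rect, subrect in *. simpl in *. lra. }
exists a, d, (INR N + 1). split; [exact Hd |].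
assert (HN0 := pos_INR N). split; [lra |]. split; [exact Hw34 |].
intros w t Hw Ht.
assert (Hw1 : Cmod w <= 1) by (specialize (Hw34 w Hw); lra).
destruct (motion_bounded_at V w (/ 2) HV Hw1) as [M [HM0 HM]]; [lra |].
set (K := M + INR N).
assert (HK : 0 < K) by (unfold K; lra).
set (eta := Rmin d (/ (4 * (4 * K) ^ 2))).
assert (P : 0 < (4 * K) ^ 2) by (apply pow_lt; lra).
assert (Heta : 0 < eta) by (apply Rmin_glb_lt; [lra | apply Rinv_0_lt_compat; lra]).
assert (Heta1 : eta <= d) by apply Rmin_l.
assert (Heta2 : (4 * K) ^ 2 * eta <= / 4).
{ apply Rle_trans with ((4 * K) ^ 2 * / (4 * (4 * K) ^ 2)).
  - apply Rmult_le_compat_l; [lra | apply Rmin_r].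
  - right. field. lra. }
specialize (Hin w Hw).
destruct (HN (Rect (fst w - eta) (fst w + eta) (snd w - eta) (snd w + eta))) as [z [Hz HzN]].
{ split; simpl; lra. }
{ unfold subrect; simpl; lra. }
assert (Hzw : Cmod (w - z) <= 2 * eta).
{ destruct w as [x y], z as [x' y']. unfold in_rect in Hz; simpl in Hz.
  change ((x, y) - (x', y'))%C with (x - x', y - y').
  eapply Rle_trans; [apply Cmod_le_abs |].
  assert (Rabs (x - x') <= eta) by (apply Rabs_le; lra).
  assert (Rabs (y - y') <= eta) by (apply Rabs_le; lra). lra. }
assert (Hz1 : Cmod z <= 1).
{ assert (in_rect r0 z); [| specialize (Hr0 z H); lra].
  unfold in_rect, subrect in *. simpl in *. lra. }
destruct (Ceq_dec w z) as [-> | nwz].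
{ specialize (HzN t). lra. }
assert (C3 : Cmod (V t w - V t z) ^ 3 <= (4 * K) ^ 2 * Cmod (V 0 w - V 0 z)).
{ apply (nowhere_equal_close (fun t => V t w) (fun t => V t z) (/ 2) K); auto; try lra.
  - intros u Hu. apply motion_Cdiff; auto; lra.
  - intros u Hu. apply motion_Cdiff; auto; lra.
  - intros u Hu. specialize (HM u). unfold K. lra.
  - intros u Hu. specialize (HzN u). unfold K. lra.
  - intros u Hu E. apply nwz. apply (motion_injective _ _ HV u); auto. unfold unit_disk. lra. }
rewrite !(motion_at_0 _ _ HV) in C3 by assumption.
assert (Cmod (V t w - V t z) < 1).
{ apply lt_of_cube_lt; [lra |]. rewrite pow1.
  apply Rle_lt_trans with (1 := C3).
  apply Rle_lt_trans with ((4 * K) ^ 2 * (2 * eta)); [apply Rmult_le_compat_l; lra | lra]. }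
generalize (Cmod_triangle_rev (V t w) (V t z)). specialize (HzN t). lra.
Qed.

(** For small [t] the image of a small disk around [a] contains a fixed disk
    around [a].  Points near the circle lie outside the small disk, so their
    images stay at distance [r / 4] from [a], and Harnack's lower bound for
    [1 / (V t z - a)] is an upper bound for [V t z]. *)
Lemma motion_bounded_near_circle V : holomorphic_motion closed_unit_disk V ->
  exists r M, 0 < r < 1 /\ 0 < M /\
    forall z t, 3 / 4 < Cmod z <= 1 -> Cmod t < r -> Cmod (V t z) <= M.
Proof.
intros HV.
destruct (motion_bounded_on_some_disc V HV) as (a & r & K & Hr & HK & Ha & HB).
assert (Hw1 : forall w, Cmod (w - a) <= r -> Cmod w <= 1).
{ intros w Hw. specialize (Ha w Hw). lra. }
set (rho := Rmin (/ 8) (r / (16 * (K + 1)))).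
assert (Hrho : 0 < rho) by (apply Rmin_glb_lt; [lra | apply Rdiv_lt_0_compat; lra]).
assert (Hrho8 : rho <= / 8) by apply Rmin_l.
assert (HrhoK : 16 * (K + 1) * rho <= r).
{ apply Rle_trans with (16 * (K + 1) * (r / (16 * (K + 1)))).
  - apply Rmult_le_compat_l; [lra | apply Rmin_r].
  - right. field. lra. }
(* The Schwarz lemma for [t |-> V t w - w], which vanishes at time 0, bounds it
   by [4 (K + 1) |t|]; [rho] makes this at most [r / 4]. *)
assert (Hid : forall w t, Cmod (w - a) <= r -> Cmod t < rho -> Cmod (V t w - w) <= r / 4).
{ intros w t Hw Ht.
  assert (S : / 4 * Cmod (V t w - w) <= (K + 1) * Cmod t).
  { apply (schwarz (fun t => V t w - w)%C (/ 4) (K + 1)); [lra | | | | lra].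
    - intros z Hz. apply Cdiff_minus; [| apply Cdiff_const].
      apply motion_Cdiff; auto. lra.
    - intros z Hz. eapply Rle_trans; [apply Cmod_triangle |]. rewrite Cmod_opp.
      specialize (HB w z Hw Hz). specialize (Hw1 w Hw). lra.
    - rewrite (motion_at_0 _ _ HV) by now apply Hw1. ring. }
  assert ((K + 1) * Cmod t <= (K + 1) * rho) by (apply Rmult_le_compat_l; lra). lra. }
assert (Hcont : forall w t, Cmod w <= r / 2 -> Cmod t < rho -> Ccont (fun w => V t (a + w)%C) w).
{ intros w t Hw Ht. apply Ccont_eps. intros e He.
  assert (P : 0 < (4 * K) ^ 2) by (apply pow_lt; lra).
  assert (Pe : 0 < e ^ 3) by (apply pow_lt; lra).
  exists (Rmin (r / 2) (e ^ 3 / (4 * K) ^ 2)). split.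
  { apply Rmin_glb_lt; [lra | now apply Rdiv_lt_0_compat]. }
  intros u Hu. apply Rmin_Rgt in Hu. destruct Hu as [Hu1 Hu2].
  destruct (Ceq_dec u w) as [-> | nuw].
  { replace (V t (a + w)%C - V t (a + w)%C)%C with (RtoC 0) by ring. now rewrite Cmod_0. }
  assert (Aw : Cmod (a + w - a) <= r) by (replace (a + w - a)%C with w by ring; lra).
  assert (Au : Cmod (a + u - a) <= r).
  { replace (a + u - a)%C with u by ring. generalize (Cmod_triangle_rev u w). lra. }
  assert (C3 : Cmod (V t (a + u)%C - V t (a + w)%C) ^ 3 <= (4 * K) ^ 2 * Cmod (V 0 (a + u)%C - V 0 (a + w)%C)).
  { apply (nowhere_equal_close (fun t => V t (a + u)%C)%C (fun t => V t (a + w)%C)%C (/ 4) K); auto; try lra.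
    - intros z Hz. apply motion_Cdiff; auto; lra.
    - intros z Hz. apply motion_Cdiff; auto; lra.
    - intros z Hz E. apply nuw. apply (motion_injective _ _ HV z) in E;
        [| unfold unit_disk; lra | now apply Hw1 | now apply Hw1].
      replace u with (a + u - a)%C by ring. rewrite E. ring. }
  rewrite !(motion_at_0 _ _ HV) in C3 by now apply Hw1.
  replace (a + u - (a + w))%C with (u - w)%C in C3 by ring.
  apply lt_of_cube_lt; [lra |]. apply Rle_lt_trans with (1 := C3).
  apply Rmult_lt_compat_l with (r := (4 * K) ^ 2) in Hu2; [| exact P].
  replace ((4 * K) ^ 2 * (e ^ 3 / (4 * K) ^ 2)) with (e ^ 3) in Hu2 by (field; lra). exact Hu2. }
assert (Hfar : forall z t, 3 / 4 < Cmod z <= 1 -> Cmod t < rho -> r / 4 <= Cmod (V t z - a)).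
{ intros z t Hz Ht. apply Rnot_lt_le. intros L.
  destruct (disc_covering (fun w => V t (a + w)%C - a)%C (r / 2) (V t z - a)%C) as [w [Hw E]]; try lra.
  - intros w Hw. apply Ccont_minus; [now apply Hcont | apply Ccont_const].
  - intros w Hw. replace (V t (a + w)%C - a - w)%C with (V t (a + w)%C - (a + w))%C by ring.
    assert (A : Cmod (a + w - a) <= r) by (replace (a + w - a)%C with w by ring; lra).
    specialize (Hid (a + w)%C t A Ht). lra.
  - assert (A : Cmod (a + w - a) <= r) by (replace (a + w - a)%C with w by ring; lra).
    assert (E' : V t (a + w)%C = V t z).
    { replace (V t (a + w)%C)%C with (V t (a + w)%C - a + a)%C by ring. rewrite E. ring. }
    apply (motion_injective _ _ HV t) in E'; [| unfold unit_disk; lra | now apply Hw1 | apply Hz].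
    specialize (Ha _ A). rewrite E' in Ha. lra. }
assert (Ha1 : Cmod a <= 1).
{ apply Hw1. replace (a - a)%C with (RtoC 0) by ring. rewrite Cmod_0. lra. }
set (c := 8 / r * (r / 16) ^ 3).
assert (Hc : 0 < c) by (apply Rmult_lt_0_compat; [apply Rdiv_lt_0_compat; lra | apply pow_lt; lra]).
exists (rho / 2), (/ c + 1). split; [lra |]. split; [generalize (Rinv_0_lt_compat c Hc); lra |].
intros z t Hz Ht.
assert (Hne : forall u, Cmod u < rho -> (V u z - a)%C <> 0).
{ intros u Hu E. specialize (Hfar z u Hz Hu). rewrite E, Cmod_0 in Hfar. lra. }
destruct (harnack_nonvanishing (fun u => 1 / (V u z - a))%C rho (4 / r)) with (t := t) as [_ H]; auto.
- apply Rdiv_lt_0_compat; lra.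
- intros u Hu. apply Cdiff_div; [apply Cdiff_const | | now apply Hne].
  apply Cdiff_minus; [| apply Cdiff_const]. apply motion_Cdiff; auto; lra.
- intros u Hu E. specialize (Hne u Hu). apply (f_equal (fun x => x * (V u z - a))%C) in E.
  rewrite Cmult_0_l in E. apply C1_nz. rewrite <- E. field. exact Hne.
- intros u Hu. rewrite Cmod_div, Cmod_1 by now apply Hne.
  replace (4 / r) with (1 / (r / 4)) by (field; lra).
  apply Rmult_le_compat_l; [lra |]. apply Rinv_le_contravar; [lra | now apply Hfar].
- assert (Htr : Cmod t < rho) by lra.
  rewrite !Cmod_div, !Cmod_1 in H by (apply Hne; rewrite ?Cmod_0; lra).
  rewrite (motion_at_0 _ _ HV) in H by apply Hz.
  set (D := Cmod (V t z - a)) in *.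
  assert (HD : 0 < D) by (apply Cmod_gt_0; now apply Hne).
  assert (HD0 : 0 < Cmod (z - a)).
  { generalize (Hfar z 0 Hz). rewrite (motion_at_0 _ _ HV) by apply Hz. rewrite Cmod_0. lra. }
  assert (Hza : Cmod (z - a) <= 2).
  { eapply Rle_trans; [apply Cmod_triangle |]. rewrite Cmod_opp. lra. }
  assert (H2 : (r / 16) ^ 3 <= (1 / Cmod (z - a) / (2 * (4 / r))) ^ 3).
  { apply pow_incr. split; [lra |].
    replace (1 / Cmod (z - a) / (2 * (4 / r))) with (/ Cmod (z - a) * (r / 8)) by (field; lra).
    assert (/ 2 <= / Cmod (z - a)) by (apply Rinv_le_contravar; lra). nra. }
  assert (H3 : c <= / D).
  { unfold c. apply Rle_trans with (8 / r * (1 / D / (2 * (4 / r)))).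
    - apply Rmult_le_compat_l; [apply Rlt_le, Rdiv_lt_0_compat; lra | lra].
    - right. field. lra. }
  assert (D <= / c) by (rewrite <- (Rinv_inv D); apply Rinv_le_contravar; auto).
  generalize (Cmod_triangle_rev (V t z) a). fold D. lra.
Qed.

(** Both [V1 t s] and [V2 t s] are the limit of [V2 t z] as [z] tends to [s]
    radially: neither function of [t] ever meets that of a point [z] of the open
    disk. *)
Lemma motions_agree_near_0 (V1 V2 : C -> C -> C) : holomorphic_motion closed_unit_disk V1 ->
  holomorphic_motion closed_unit_disk V2 ->
  (forall t s z, Cmod t < 1 -> Cmod s = 1 -> Cmod z < 1 -> V1 t s <> V2 t z) ->
  exists r, 0 < r /\ forall t s, Cmod t < r -> Cmod s = 1 -> V1 t s = V2 t s.
Proof.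
intros H1 H2 Hn.
destruct (motion_bounded_near_circle V1 H1) as (r1 & M1 & Hr1 & HM1 & B1).
destruct (motion_bounded_near_circle V2 H2) as (r2 & M2 & Hr2 & HM2 & B2).
set (r := Rmin r1 r2). set (M := Rmax M1 M2).
assert (Hr : 0 < r) by (apply Rmin_glb_lt; lra).
assert (Lr1 : r <= r1) by apply Rmin_l. assert (Lr2 : r <= r2) by apply Rmin_r.
assert (LM1 : M1 <= M) by apply Rmax_l. assert (LM2 : M2 <= M) by apply Rmax_r.
exists (r / 2). split; [lra |]. intros t s Ht Hs.
apply Ceq_minus, Cmod_eq_0, Rle_antisym; [| apply Cmod_ge_0]. apply Rnot_lt_le.
set (D := Cmod (V1 t s - V2 t s)). intros HD.
assert (P : 0 < (4 * M) ^ 2) by (apply pow_lt; lra).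
assert (PD : 0 < (D / 2) ^ 3) by (apply pow_lt; lra).
set (eta := Rmin (/ 8) ((D / 2) ^ 3 / (2 * (4 * M) ^ 2))).
assert (He : 0 < eta) by (apply Rmin_glb_lt; [lra | apply Rdiv_lt_0_compat; lra]).
assert (He8 : eta <= / 8) by apply Rmin_l.
assert (HeD : (4 * M) ^ 2 * eta < (D / 2) ^ 3).
{ apply Rle_lt_trans with ((4 * M) ^ 2 * ((D / 2) ^ 3 / (2 * (4 * M) ^ 2))).
  - apply Rmult_le_compat_l; [lra | apply Rmin_r].
  - replace ((4 * M) ^ 2 * ((D / 2) ^ 3 / (2 * (4 * M) ^ 2))) with ((D / 2) ^ 3 / 2) by (field; lra). lra. }
set (z := (RtoC (1 - eta) * s)%C).
assert (Hz : Cmod z = 1 - eta).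
{ unfold z. rewrite Cmod_mult, Cmod_R, Hs, Rabs_pos_eq; lra. }
assert (Hsz : Cmod (s - z) = eta).
{ replace (s - z)%C with (RtoC eta * s)%C by (unfold z; rewrite RtoC_minus; ring).
  rewrite Cmod_mult, Cmod_R, Hs, Rabs_pos_eq; lra. }
assert (A1 : Cmod (V1 t s - V2 t z) < D / 2).
{ apply lt_of_cube_lt; [lra |].
  assert (C3 := nowhere_equal_close (fun t => V1 t s) (fun t => V2 t z) r M).
  simpl in C3. eapply Rle_lt_trans; [apply C3; try lra |].
  - intros u Hu. apply motion_Cdiff; auto; lra.
  - intros u Hu. apply motion_Cdiff; auto; lra.
  - intros u Hu. apply Rle_trans with M1; [apply B1; lra | lra].
  - intros u Hu. apply Rle_trans with M2; [apply B2; lra | lra].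
  - intros u Hu. apply Hn; lra.
  - rewrite (motion_at_0 _ _ H1), (motion_at_0 _ _ H2), Hsz by (unfold closed_unit_disk; lra). exact HeD. }
assert (A2 : Cmod (V2 t s - V2 t z) < D / 2).
{ apply lt_of_cube_lt; [lra |].
  assert (C3 := nowhere_equal_close (fun t => V2 t s) (fun t => V2 t z) r M).
  simpl in C3. eapply Rle_lt_trans; [apply C3; try lra |].
  - intros u Hu. apply motion_Cdiff; auto; lra.
  - intros u Hu. apply motion_Cdiff; auto; lra.
  - intros u Hu. apply Rle_trans with M2; [apply B2; lra | lra].
  - intros u Hu. apply Rle_trans with M2; [apply B2; lra | lra].
  - intros u Hu E. apply (motion_injective _ _ H2 u) in E;
      [| unfold unit_disk; lra | unfold closed_unit_disk; lra | unfold closed_unit_disk; lra].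
    rewrite E in Hs. lra.
  - rewrite !(motion_at_0 _ _ H2), Hsz by (unfold closed_unit_disk; lra). exact HeD. }
assert (T : D <= Cmod (V1 t s - V2 t z) + Cmod (V2 t s - V2 t z)).
{ unfold D. replace (V1 t s - V2 t s)%C with ((V1 t s - V2 t z) + - (V2 t s - V2 t z))%C by ring.
  eapply Rle_trans; [apply Cmod_triangle |]. rewrite Cmod_opp. lra. }
lra.
Qed.

Theorem proposition10 (W1 W2 : C -> C -> C) (B1 B2 : C * C -> Prop)
  (hW1 : holomorphic_motion unit_circle W1)
  (hW2 : holomorphic_motion unit_circle W2)
  (hB1 : is_graph W1 B1)
  (hB2 : is_graph W2 B2)
  (hB : forall p : C * C, B1 p <-> B2 p) :
  forall t s : C, unit_disk t -> unit_circle s -> W1 t s = W2 t s.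
Proof.
destruct hB1 as (V1 & [HV1 E1] & G1). destruct hB2 as (V2 & [HV2 E2] & G2).
intros t s Ht Hs. rewrite <- E1, <- E2 by assumption.
destruct (motions_agree_near_0 V1 V2 HV1 HV2) as (r & Hr & Hag).
{ intros u x z Hu Hx Hz E.
  assert (M : B1 (u, V2 u z)).
  { apply hB, G2. exists u, z. auto. }
  apply G1 in M. destruct M as (u' & z' & _ & Hz' & Eq).
  injection Eq as <- Eq. rewrite <- E in Eq.
  apply (motion_injective _ _ HV1 u) in Eq; auto.
  - subst z'. unfold unit_disk in Hz'. lra.
  - unfold closed_unit_disk. lra.
  - unfold closed_unit_disk, unit_disk in *. lra. }
apply Ceq_minus.
apply (identity_theorem (fun u => V1 u s - V2 u s)%C r Hr); [| | exact Ht].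
- unfold unit_circle in Hs. intros u Hu. apply Cdiff_minus; apply motion_Cdiff; auto; lra.
- intros u Hu. now apply (proj1 (Ceq_minus _ _)), Hag.
Qed.
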